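(* There exists an absolute constant $c>0$, and for every $u,v\in(0,1)$ there exist positive constants $b, M$ depending only on $u$ and $v$, such that the following holds. Let $n,N$ be positive integers with $N\ge Mn$ and let $\Gamma=\{\xi_{ij}\}_{1\le i\le N,\,1\le j\le n}$ be an $N\times n$ random matrix whose entries are independent symmetric real random variables with unit variances, such that in each row the entries are identically distributed, and such that $$\sup_{\lambda\in\mathbb{R}}\mathbb{P}\{|\xi_{ij}-\lambda|\le u\}\le v\quad\text{for all } i,j.$$ Then with probability at least $1-\exp(-cn)$ one has $$\Gamma^* B_1^N\supset b^{-1}\left(B_\infty^n\cap\sqrt{\ln(N/n)}\,B_2^n\right).$$
   Context: $B_p^m$ denotes the closed unit ball of $\ell_p^m=(\mathbb{R}^m,\|\cdot\|_p)$. $\Gamma^*$ is the transpose of $\Gamma$, so $\Gamma^*B_1^N$ is the absolute convex hull of the rows of $\Gamma$. *)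

(* Defs.v *)
From HB Require Import structures.
From mathcomp Require Export all_boot all_order all_algebra.
From mathcomp Require Export all_classical all_reals all_analysis.

Set Implicit Arguments.
Unset Strict Implicit.
Unset Printing Implicit Defensive.

Import Order.TTheory GRing.Theory Num.Theory.
Import numFieldNormedType.Exports.

Local Open Scope classical_set_scope.
Local Open Scope ring_scope.

Section ell_p.
Context {R : realType}.
Implicit Type p : \bar R.

(* Only meant for 1 <= p <= +oo; the value at p = -oo is junk. *)
Definition ell_norm p (m : nat) (x : 'cV[R]_m) : R :=
  match p with
  | r%:E => (\sum_(i < m) `|x i 0| `^ r) `^ r^-1
  | +oo%E => \big[Num.max/0]_(i < m) `|x i 0|
  | -oo%E => 0
  end.

Definition ell_ball p (m : nat) : set 'cV[R]_m := [set x | ell_norm p x <= 1].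

Definition dilate (t : R) (m : nat) (A : set 'cV[R]_m) : set 'cV[R]_m :=
  [set t *: x | x in A].

End ell_p.

Arguments ell_ball {R} p%_ereal_scope m%_nat_scope _.

Section random_variables.
Context {d : measure_display} {T : measurableType d} {R : realType}.
Variable P : probability T R.

Definition mutually_independent (I : finType) (X : I -> {RV P >-> R}) : Prop :=
  forall (J : {set I}) (A : I -> set R), (forall i, measurable (A i)) ->
    P (\bigcap_(i in [set` J]) (X i @^-1` A i)) =
    (\prod_(i in J) P (X i @^-1` A i))%E.

Definition identically_distributed (X Y : T -> R) : Prop :=
  forall A : set R, measurable A -> P (X @^-1` A) = P (Y @^-1` A).

Definition symmetric_rv (X : T -> R) : Prop :=
  identically_distributed X (\- X).

Definition levy_concentration (X : T -> R) (u : R) : \bar R :=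
  ereal_sup (range (fun l : R => P [set w | `|X w - l| <= u])).

Definition random_matrix (N n : nat) (xi : 'I_N -> 'I_n -> {RV P >-> R})
  (w : T) : 'M[R]_(N, n) := \matrix_(i < N, j < n) xi i j w.

End random_variables.

(* Main.v *)
(* Let X_1, ..., X_N be the rows, k = ln(N/n), L the body on the right-hand side
   (before scaling by 1/b) and h_L its support function.  By duality the
   inclusion fails iff some y satisfies |X_i . y| < h_L(y)/b for all i.

   Small ball: if h_L(y) >= 1 then P(|X_i . y| > s) >= e^(-k/2) for a small
   s = s(u, v).  Pick x in L with x . y >= max(1, |y|_2) and tilt the law of the
   row by the density D = prod_j (1 + t_j sign(xi_j) 1_{|xi_j| > u}) with t_j
   proportional to x_j: the sum X_i . y then has mean of order x . y and
   comparable standard deviation, while E D^2 <= e^(k/4).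

   Union bound: no net is used, so no control of the norm of the matrix is
   needed.  If some y is bad then, after scaling |y|_oo <= 1, so is a vertex of
   the polytope {|X_i . y| <= s, |y_j| <= 1}, and a vertex is determined by n of
   the N + n constraints and n signs.  The rows not used by a vertex are
   independent of it, so each of the 2^n C(N + n, n) candidates is bad with
   probability at most (1 - e^(-k/2))^(N - n). *)

Require Import Defs.
From HB Require Import structures.
From mathcomp Require Import all_boot all_order all_algebra.
From mathcomp Require Import all_classical all_reals all_analysis.
From mathcomp Require Import measurable_realfun.
From mathcomp Require Import ring lra.

Set Implicit Arguments.
Unset Strict Implicit.
Unset Printing Implicit Defensive.

Import Order.TTheory GRing.Theory Num.Theory.
Import numFieldNormedType.Exports.

Local Open Scope classical_set_scope.
Local Open Scope ring_scope.

(** * Independence *)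

(** Only second moments are available, so an exponential tilt may fail to exist; the density is
    built instead from the bounded odd function sign(z) 1_{|z| > u}. By symmetry this tilt keeps the
    total mass and the second moments of the entries equal to 1 and moves only the means, at a cost
    E D^2 controlled by |x|_2^2 <= k alone. The budget: there are about exp(n(k + 3)) candidates,
    while a row success probability p contributes about exp(-n e^k p) because N = n e^k; hence p =
    e^(-k/2) suffices once k is large. Vertices therefore enter through Cramer numerators, which are
    polynomial in the entries, and smallness of the conditional probability is made part of the bad
    event itself. This dictates the Fubini statement for two independent sub-sigma-algebras of T. *)

Section sub_sigma_algebra.
Context {d : measure_display} {T : measurableType d} {R : realType}.
Variable P : probability T R.

(** For fixed B, both P(. [&] B) and P(B) P(.) are finite measures; they agree on the pi-system G,
    hence on the sigma-algebra it generates. *)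
Lemma independent_generated (G : set (set T)) (B : set T) :
  G `<=` measurable -> setI_closed G -> G setT -> measurable B ->
  (forall A, G A -> P (A `&` B) = P A * P B)%E ->
  forall A, <<s G >> A -> P (A `&` B) = (P A * P B)%E.
Proof.
move=> mG GI GT mB indG A sA.
have fB : P B \is a fin_num by exact: fin_num_measure.
pose r : {nonneg R} := NngNum (fine_ge0 (measure_ge0 P B)).
have E C : mscale r P C = (P C * P B)%E.
  by rewrite /mscale /= fineK// muleC.
rewrite -E.
apply: (g_sigma_algebra_measure_unique G mG (fun=> setT) _ _
  (mrestr P mB) (mscale r P)) => //.
- by rewrite bigcup_const//; exists 0%N.
- by move=> C GC; rewrite [RHS]E -indG.
- by move=> _; rewrite [X in (X < _)%E](_ : _ = P B) ?ltey_eq ?fB// /= /mrestr setTI.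
Qed.

Lemma measurable_generated (G : set (set T)) :
  G `<=` measurable -> <<s G >> `<=` (measurable : set (set T)).
Proof. by move=> mG; apply: smallest_sub => //; exact: sigma_algebra_measurable. Qed.

Variables (G1 G2 : set (set T)).
Hypotheses (mG1 : G1 `<=` measurable) (mG2 : G2 `<=` measurable).
Hypothesis indG : forall A B, <<s G1 >> A -> <<s G2 >> B ->
  P (A `&` B) = (P A * P B)%E.

Local Notation T1 := (g_sigma_algebraType G1).
Local Notation T2 := (g_sigma_algebraType G2).

Let id1 : T -> T1 := id.
Let id2 : T -> T2 := id.
Let diag : T -> T1 * T2 := fun w => (w, w).

Let mid1 : measurable_fun setT id1.
Proof. by move=> _ A mA; rewrite setTI; exact: measurable_generated mA. Qed.
Let mid2 : measurable_fun setT id2.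
Proof. by move=> _ A mA; rewrite setTI; exact: measurable_generated mA. Qed.
Let mdiag : measurable_fun setT diag.
Proof. exact: measurable_fun_pair. Qed.

HB.instance Definition _ := @isMeasurableFun.Build _ _ _ _ id1 mid1.
HB.instance Definition _ := @isMeasurableFun.Build _ _ _ _ id2 mid2.
HB.instance Definition _ := @isMeasurableFun.Build _ _ _ _ diag mdiag.

Let P1 : probability T1 R := distribution P id1.
Let P2 : probability T2 R := distribution P id2.

(** The diagonal pulls a rectangle A x B back to A [&] B, so independence is the product formula on
    rectangles, which characterizes the product measure. *)
Let diagE (F : set (T1 * T2)) : measurable F ->
  (P1 \x P2)%E F = distribution P diag F.
Proof.
by move=> mF; apply: product_measure_unique => // A B mA mB; rewrite -indG.
Qed.


(* Fubini for two independent sub-sigma-algebras of T: their joint law is the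
   image of P under the diagonal map T -> T1 * T2. *)
Lemma diagonal_section_bound (F : set (T1 * T2)) (e : R) : 0 <= e ->
  measurable F ->
  let D : set T := [set w | F (w, w) /\ (P [set w' | F (w, w')] <= e%:E)%E] in
  measurable D /\ (P D <= e%:E)%E.
Proof.
move=> e0 mF D.
pose S : set T1 := [set w | (P2 (xsection F w) <= e%:E)%E].
have mS : measurable S.
  rewrite -[S]setTI; apply: measurable_lee => //.
  exact: measurable_fun_xsection.
(* Sections of F' over points outside S are empty and the others have measure at most e, so
   integrating over the first factor gives e. *)
pose F' := F `&` (S `*` setT).
have mF' : measurable F' by apply: measurableI => //; exact: measurableX.
have xE (F0 : set (T1 * T2)) w : xsection F0 w = [set w' | F0 (w, w')].
  by apply/seteqP; split=> w' /=; rewrite /xsection /= ?inE.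
have DE : D = diag @^-1` F'.
  apply/seteqP; split=> [w [Fw Pw]|w [Fw [/= Sw _]]].
    by split => //; split => //=; rewrite /S /= xE.
  by split => //; move: Sw; rewrite /S /= xE.
split.
  by rewrite DE -[X in measurable X]setTI; exact: mdiag.
rewrite DE -[X in (X <= _)%E]/(distribution P diag F') -diagE//.
rewrite /product_measure1.
apply: (@le_trans _ _ (\int[P1]_x (cst e%:E x))%E); last first.
  rewrite integral_cst// [X in (_ * X)%E](_ : _ = 1%E) ?mule1//.
  exact: (probability_setT P).
apply: ge0_le_integral => //.
- exact: measurable_fun_xsection.
- move=> w _ /=; rewrite xE; have [Sw|nSw] := pselect (S w).
    apply: le_trans Sw; rewrite xE; apply: le_measure; rewrite ?inE.
    + by rewrite -xE; exact: measurable_xsection.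
    + by rewrite -xE; exact: measurable_xsection.
    + by move=> w' [].
  rewrite [X in P2 X](_ : _ = set0) ?measure0//.
  by apply/seteqP; split => // w' [_ []].
Qed.

Let prodE (u : T1 * T2 -> \bar R) :
  (\int[(P1 \x P2)%E]_z u z = \int[distribution P diag]_z u z)%E.
Proof. by apply: eq_measure_integral => A mA _; exact: diagE. Qed.

(** Tonelli needs no integrability; applied to absolute values, this case yields the integrability
    of the product in the signed case. *)
Let ge0_independent_integralM (u : T1 -> \bar R) (v : T2 -> \bar R) :
  measurable_fun [set: T1] u -> measurable_fun [set: T2] v ->
  (forall w, 0 <= u w)%E -> (forall w, 0 <= v w)%E ->
  (\int[P]_w ((u : T -> _) w * (v : T -> _) w) =
   \int[P]_w (u : T -> _) w * \int[P]_w (v : T -> _) w)%E.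
Proof.
move=> mu mv u0 v0.
pose h (z : T1 * T2) : \bar R := (u z.1 * v z.2)%E.
have mh : measurable_fun setT h.
  apply: emeasurable_funM.
    exact: measurableT_comp mu measurable_fst.
  exact: measurableT_comp mv measurable_snd.
have h0 z : (0 <= h z)%E by exact: mule_ge0.
transitivity (\int[distribution P diag]_z h z)%E.
  by rewrite ge0_integral_distribution.
rewrite -prodE fubini_tonelli1// /fubini_F /h /=.
under eq_integral do rewrite ge0_integralZl//.
rewrite ge0_integralZr//; last exact: integral_ge0.
by rewrite !ge0_integral_distribution.
Qed.

Lemma independent_integralM (f : T1 -> R) (g : T2 -> R) :
  measurable_fun [set: T1] f -> measurable_fun [set: T2] g ->
  P.-integrable setT (EFin \o (f : T -> R)) ->
  P.-integrable setT (EFin \o (g : T -> R)) ->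
  P.-integrable setT (EFin \o (fun w : T => f w * g w)) /\
  (\int[P]_w (f w * g w)%:E = \int[P]_w (f w)%:E * \int[P]_w (g w)%:E)%E.
Proof.
move=> mf mg intf intg.
pose h (z : T1 * T2) : \bar R := (f z.1 * g z.2)%:E.
have mh : measurable_fun setT h.
  apply/measurable_EFinP; apply: measurable_funM.
    exact: measurableT_comp mf measurable_fst.
  exact: measurableT_comp mg measurable_snd.
have inth : P.-integrable setT (h \o diag).
  apply/integrableP; split; first exact: measurableT_comp mh mdiag.
  under eq_integral => w _ do rewrite [(_ \o _) _]EFinM abseM.
  rewrite (ge0_independent_integralM (u := abse \o (EFin \o f))
    (v := abse \o (EFin \o g)))//.
  - apply: lte_mul_pinfty.
    + by apply: integral_ge0 => w _; exact: abse_ge0.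
    + by apply: integrable_fin_num => //; exact: integrable_abse.
    + by move/integrableP : intg => [].
  - by apply: measurableT_comp => //; exact/measurable_EFinP.
  - by apply: measurableT_comp => //; exact/measurable_EFinP.
  - by move=> w; exact: abse_ge0.
  - by move=> w; exact: abse_ge0.
split => //.
transitivity (\int[distribution P diag]_z h z)%E.
  by rewrite integral_distribution.
have ihp : (P1 \x P2)%E.-integrable setT h.
  apply/integrableP; split => //; rewrite prodE.
  have : (pushforward P diag).-integrable setT h.
    by apply: integrable_pushforward.
  by move/integrableP => [].
have intg2 : P2.-integrable setT (EFin \o g).
  apply: (integrable_pushforward mid2) => //; exact/measurable_EFinP.
rewrite -prodE -integral12_prod_meas1// /fubini_F /h /=.
transitivity (\int[P1]_x ((f x)%:E * \int[P2]_y (g y)%:E))%E.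
  by apply: eq_integral => x _; rewrite -integralZl.
have fg2 : (\int[P2]_w (g w)%:E)%E \is a fin_num by exact: integrable_fin_num.
rewrite -(fineK fg2) integralZr//; last first.
  apply: (integrable_pushforward mid1) => //; exact/measurable_EFinP.
rewrite fineK//.
by congr (_ * _)%E; apply: integral_distribution => //; exact/measurable_EFinP.
Qed.

End sub_sigma_algebra.

(** * Disjoint blocks of a mutually independent family *)

Section mutual_independence.
Context {d : measure_display} {T : measurableType d} {R : realType}.
Variable P : probability T R.
Context {I : finType}.
Variable X : I -> {RV P >-> R}.

(** A pi-system generating the sigma-algebra of the X_i with i in J, made of exactly the sets on
    which mutual independence is stated. *)
Definition cylinders (J : {set I}) : set (set T) :=
  [set C | exists2 A : I -> set R, (forall i, measurable (A i)) &
                     C = \bigcap_(i in [set` J]) (X i @^-1` A i)].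

Local Notation sub J := (g_sigma_algebraType (cylinders J)).

Lemma cylinders_measurable J : cylinders J `<=` measurable.
Proof.
move=> _ [A mA ->]; apply: fin_bigcap_measurable => //.
by move=> i _; rewrite -[X in measurable X]setTI; exact: measurable_funP.
Qed.

Lemma cylinders_setI J : setI_closed (cylinders J).
Proof.
move=> _ _ [A mA ->] [B mB ->]; exists (fun i => A i `&` B i).
  by move=> i; exact: measurableI.
by rewrite -bigcapI.
Qed.

Lemma cylindersT J : cylinders J setT.
Proof. by exists (fun=> setT) => //; rewrite bigcapT. Qed.

Lemma cylindersS (J1 J2 : {set I}) : J1 \subset J2 ->
  <<s cylinders J1 >> `<=` <<s cylinders J2 >>.
Proof.
move=> J12; apply: sub_smallest2r => [|_ [A mA ->]].
  exact: smallest_sigma_algebra.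
exists (fun i => if i \in J1 then A i else setT); first by move=> i; case: ifP.
apply/seteqP; split=> [w Aw i _|w Aw i iJ1]; rewrite /=.
  by case: ifP => // /Aw.
by have := Aw i (fintype.subsetP J12 _ iJ1); rewrite /= iJ1.
Qed.

Lemma measurable_cylinders (J : {set I}) i : i \in J -> measurable_fun [set: sub J] (X i).
Proof.
move=> iJ _ A mA; rewrite setTI; apply: sub_sigma_algebra.
exists (fun k => if k == i then A else setT); first by move=> k; case: ifP.
apply/seteqP; split=> [w Aw k _|w]; rewrite /=.
  by case: eqP => // ->.
by move/(_ i iJ); rewrite /= eqxx.
Qed.

Hypothesis indX : mutually_independent X.

(** The pi-system argument is used twice, once for each side; on two cylinders the claim is mutual
    independence for the merged family [A']. *)
Lemma independent_cylinders (J1 J2 : {set I}) : [disjoint J1 & J2]%B ->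
  forall A B, <<s cylinders J1 >> A -> <<s cylinders J2 >> B ->
  P (A `&` B) = (P A * P B)%E.
Proof.
move=> J12 A B sA sB.
have mJ J := @cylinders_measurable J.
apply: (independent_generated (mJ J1)) sA => //.
- exact: cylinders_setI.
- exact: cylindersT.
- exact: measurable_generated sB.
move=> C1 cC1; rewrite setIC muleC.
apply: (independent_generated (mJ J2)) sB => //.
- exact: cylinders_setI.
- exact: cylindersT.
- exact: mJ cC1.
move=> _ [A2 mA2 ->]; case: cC1 => A1 mA1 ->.
pose A' i := if i \in J1 then A1 i else A2 i.
have -> : \bigcap_(i in [set` J2]) (X i @^-1` A2 i) `&`
          \bigcap_(i in [set` J1]) (X i @^-1` A1 i) =
          \bigcap_(i in [set` J1 :|: J2]) (X i @^-1` A' i).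
  apply/seteqP; split=> [w [A2w A1w] i /=|w Aw].
    rewrite inE /A'; case: ifPn => [iJ1 _|_ /= iJ2]; first exact: A1w.
    exact: A2w.
  split=> i iJ; have := Aw i; rewrite /= /A' inE iJ ?orbT => /(_ erefl) //.
  by have /disjointFl -> := J12.
rewrite indX; last by move=> i; rewrite /A'; case: ifP.
rewrite (eq_bigl [predU J1 & J2]); last by move=> i; rewrite !inE.
rewrite bigU//= muleC indX// indX//; congr (_ * _)%E.
  by apply: eq_bigr => i iJ; rewrite /A' (disjointFl J12 iJ).
by apply: eq_bigr => i iJ; rewrite /A' iJ.
Qed.

Lemma independent_bigcap (K : eqType) (J : K -> {set I}) (B : K -> set T)
    (s : seq K) :
  uniq s -> (forall k l, k != l -> [disjoint J k & J l]%B) ->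
  (forall k, <<s cylinders (J k) >> (B k)) ->
  P (\big[setI/setT]_(k <- s) B k) = (\prod_(k <- s) P (B k))%E.
Proof.
move=> us dJ sB.
(* The induction must also carry that the partial intersection depends only on the blocks already
   treated, from which the next block is disjoint. *)
suff [] : <<s cylinders (\bigcup_(k <- s) J k) >> (\big[setI/setT]_(k <- s) B k)
  /\ P (\big[setI/setT]_(k <- s) B k) = (\prod_(k <- s) P (B k))%E by [].
elim: s us => [_|k s IH /= /andP[ks us]].
  rewrite !big_nil; split; last exact: probability_setT.
  by apply: sub_sigma_algebra; exact: cylindersT.
have [sIH PIH] := IH us; rewrite !big_cons; split.
  apply: (@measurableI _ (sub _)).
    exact: (cylindersS (finset.subsetUl _ _)) (sB k).
  exact: (cylindersS (finset.subsetUr _ _)) sIH.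
rewrite -PIH; apply: (independent_cylinders _ (sB k) sIH).
rewrite disjoint_sym; elim: s ks {IH us sIH PIH} => [|l s IH].
  by rewrite big_nil -setI_eq0 finset.set0I.
rewrite inE negb_or big_cons => /andP[kl ks].
rewrite -setI_eq0 finset.setIUl finset.setU_eq0 !setI_eq0 IH// andbT.
by rewrite dJ// eq_sym.
Qed.

Lemma independent_integral_prod (f : I -> R -> R) (s : seq I) : uniq s ->
  (forall i, measurable_fun setT (f i)) ->
  (forall i, P.-integrable setT (EFin \o (f i \o X i))) ->
  let F w := \prod_(i <- s) f i (X i w) in
  P.-integrable setT (EFin \o F) /\
  \int[P]_w F w = \prod_(i <- s) \int[P]_w f i (X i w).
Proof.
move=> us mf intf /=.
suff [] : [/\ measurable_fun [set: sub [set i in s]]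
      (fun w => \prod_(i <- s) f i (X i w)),
    P.-integrable setT (EFin \o (fun w => \prod_(i <- s) f i (X i w))) &
    \int[P]_w \prod_(i <- s) f i (X i w) =
    \prod_(i <- s) \int[P]_w f i (X i w)] by [].
elim: s us => [_|k s IH /= /andP[ks us]].
  rewrite (_ : (fun w => \prod_(i <- [::]) f i (X i w)) = cst 1); last first.
    by apply/funext => w; rewrite big_nil.
  rewrite big_nil; split => //.
    exact: finite_measure_integrable_cst.
  by rewrite Rintegral_cst// [X in fine X]probability_setT mul1r.
have [mIH iIH EIH] := IH us.
rewrite (_ : (fun w => \prod_(i <- k :: s) f i (X i w)) =
    (fun w => f k (X k w) * \prod_(i <- s) f i (X i w))); last first.
  by apply/funext => w; rewrite big_cons.
have mfX (J : {set I}) i : i \in J -> measurable_fun [set: sub J] (f i \o X i).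
  by move=> iJ; apply: measurableT_comp => //; exact: measurable_cylinders.
have [||iM EM] := @independent_integralM _ _ _ P (cylinders [set k]%SET)
  (cylinders [set i in s]) (@cylinders_measurable _) (@cylinders_measurable _)
  _ (f k \o X k) (fun w => \prod_(i <- s) f i (X i w)) _ mIH (intf k) iIH.
- apply: independent_cylinders; rewrite disjoints1 inE //.
- by apply: mfX; rewrite inE.
split => //.
  apply: measurable_funM; first by apply: mfX; rewrite !inE eqxx.
  move=> _ A mA; rewrite setTI.
  apply: (@cylindersS [set i in s]); last by rewrite -[X in <<s _ >> X]setTI; exact: mIH.
  by apply/fintype.subsetP => i; rewrite !inE => ->; rewrite orbT.
rewrite big_cons -EIH /Rintegral EM fineM//.
  exact: integrable_fin_num (intf k).
exact: integrable_fin_num iIH.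
Qed.

End mutual_independence.

(** * Small ball estimate for one row *)

Section symmetric_moments.
Context {d : measure_display} {T : measurableType d} {R : realType}.
Variable P : probability T R.

(** Equality of the laws of X and -X gives E h(X) = E h(-X) = -E h(X); integrability rules out
    infinite values. *)
Lemma symmetric_integral_odd (X : {RV P >-> R}) (h : R -> R) :
  symmetric_rv P X -> measurable_fun setT h -> (forall z, h (- z) = - h z) ->
  P.-integrable setT (EFin \o (h \o X)) -> \int[P]_w h (X w) = 0.
Proof.
move=> symX mh oddh inth.
have mN : measurable_fun setT (\- X : T -> R) by exact: measurable_funN.
pose Y : {RV P >-> R} := mfun_Sub (mem_set mN).
have intN : P.-integrable setT (EFin \o (h \o Y)).
  rewrite (_ : EFin \o _ = (-%E \o (EFin \o (h \o X)))); first exact: integrableN.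
  by apply/funext => w /=; rewrite oddh.
have : (\int[P]_w (h (X w))%:E = \int[P]_w (h (Y w))%:E)%E.
  rewrite -[LHS](@integral_distribution _ _ _ _ _ P X (EFin \o h))//; last first.
    exact/measurable_EFinP.
  rewrite -[RHS](@integral_distribution _ _ _ _ _ P Y (EFin \o h))//; last first.
    exact/measurable_EFinP.
  by apply: eq_measure_integral => A mA _; exact: symX.
rewrite [X in _ = X -> _](_ : _ = - \int[P]_w (h (X w))%:E)%E; last first.
  rewrite -integralN/=; last exact: integrable_add_def.
  by apply: eq_integral => w _ /=; rewrite oddh.
rewrite /Rintegral; move/integrable_fin_num : inth => /(_ measurableT) /=.
move: (integral _ _ _) => [r| |]//= _ [].
by move=> rN; lra.
Qed.

(** Integrability is extracted from the value of the variance. The centering [c] is a real number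
    whatever the mean is; as (X - c)^2 has integral 1, X^2 and X are integrable, and only then does
    symmetry give c = 0. *)
Lemma unit_variance_moments (X : {RV P >-> R}) :
  symmetric_rv P X -> 'V_P[X] = 1%E ->
  [/\ P.-integrable setT (EFin \o X),
      P.-integrable setT (EFin \o (fun w => X w ^+ 2)) &
      \int[P]_w X w ^+ 2 = 1].
Proof.
move=> symX varX; set c := fine 'E_P[X]%E.
have mX : measurable_fun setT X by [].
have mXc : measurable_fun setT (fun w => (X w - c) ^+ 2).
  by apply: measurable_funX; apply: measurable_funB => //; exact: measurable_cst.
have mX2 : measurable_fun setT (fun w => X w ^+ 2) by exact: measurable_funX.
have VE : (\int[P]_w ((X w - c) ^+ 2)%:E = 1)%E.
  rewrite -varX /variance covariance.unlock -/c expectation.unlock.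
  by apply: eq_integral => w _ /=; rewrite expr2.
have iXc : P.-integrable setT (EFin \o (fun w => (X w - c) ^+ 2)).
  apply/integrableP; split; first exact/measurable_EFinP.
  under eq_integral => w _ do rewrite /= ger0_norm ?sqr_ge0//.
  by rewrite VE ltry.
have iX2 : P.-integrable setT (EFin \o (fun w => X w ^+ 2)).
  have i2 : P.-integrable setT
      (EFin \o (fun w => 2 * (X w - c) ^+ 2 + 2 * c ^+ 2)).
    apply: (@integrableD _ _ _ P setT measurableT
      (EFin \o (fun w => 2 * (X w - c) ^+ 2)) (cst (2 * c ^+ 2)%:E)).
      exact: (@integrableZl _ _ _ P setT measurableT 2 _ iXc).
    exact: finite_measure_integrable_cst.
  apply: le_integrable i2 => //; first exact/measurable_EFinP.
  move=> w _ /=; rewrite lee_fin !ger0_norm ?sqr_ge0//.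
    by have := sqr_ge0 (X w - 2 * c); rewrite !expr2; lra.
  by rewrite addr_ge0// mulr_ge0// sqr_ge0.
have iX : P.-integrable setT (EFin \o X).
  have i1 : P.-integrable setT (EFin \o (fun w => 1 + X w ^+ 2)).
    apply: (@integrableD _ _ _ P setT measurableT
      (cst 1%:E) (EFin \o (fun w => X w ^+ 2))) => //.
    exact: finite_measure_integrable_cst.
  apply: le_integrable i1 => //; first exact/measurable_EFinP.
  move=> w _ /=; rewrite lee_fin [leRHS]ger0_norm ?addr_ge0 ?sqr_ge0//.
  rewrite -[X w ^+ 2]real_normK ?num_real//.
  by have := sqr_ge0 (`|X w| - 1); rewrite !expr2; nra.
have c0 : c = 0.
  rewrite /c unlock -[LHS]/(\int[P]_w X w).
  by apply: (@symmetric_integral_odd X id).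
split => //; rewrite /Rintegral.
by under eq_integral => w _ do rewrite -[X w]subr0 -c0; rewrite VE.
Qed.

(** For u > 0 this is sign(z) 1_{|z| > u}, as a difference of two indicators. *)
Definition tail_sign (u z : R) : R := (u < z)%R%:R - (z < - u)%R%:R.

Lemma measurable_tail_sign u : measurable_fun setT (tail_sign u).
Proof.
rewrite (_ : tail_sign u = \1_(`]u, +oo[%classic) \- \1_(`]-oo, - u[%classic)).
  by apply: measurable_funB; exact: measurable_indic.
by apply/funext => z /=; rewrite /tail_sign !indicE !mem_setE !in_itv/= andbT.
Qed.

Lemma tail_signN u z : tail_sign u (- z) = - tail_sign u z.
Proof. by rewrite !/tail_sign ltrNr ltrN2 opprB. Qed.

Lemma tail_sign_norm u z : 0 < u -> `|tail_sign u z| = (u < `|z|)%R%:R.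
Proof.
move=> u0; rewrite /tail_sign ltr_normr [u < - z]ltrNr.
have [uz|_] := ltP u z; have [zu|_] := ltP z (- u) => /=;
  rewrite ?subr0 ?sub0r ?normrN ?normr1 ?normr0//.
by exfalso; lra.
Qed.

Lemma mul_tail_sign u z : 0 < u -> z * tail_sign u z = `|z| * (u < `|z|)%R%:R.
Proof.
move=> u0; rewrite /tail_sign ltr_normr [u < - z]ltrNr.
have [uz|_] := ltP u z; have [zu|_] := ltP z (- u) => /=;
  rewrite ?subr0 ?sub0r ?mulr1 ?mulr0 ?mulrN1//.
- by exfalso; lra.
- by rewrite gtr0_norm//; lra.
- by rewrite ltr0_norm//; lra.
Qed.

Lemma tail_sign_le1 u z : 0 < u -> `|tail_sign u z| <= 1.
Proof. by move=> u0; rewrite tail_sign_norm//; case: ltP. Qed.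

End symmetric_moments.

(** * Moments of one entry under the tilted law *)

Section tilted_moments.
Context {d : measure_display} {T : measurableType d} {R : realType}.
Variable P : probability T R.
Variables (u v : R) (X : {RV P >-> R}).
Hypothesis (u0 : 0 < u).
Hypothesis symX : symmetric_rv P X.
Hypothesis varX : 'V_P[X] = 1%E.

(** One factor of the density D times z^a: integrating it for a = 0, 1, 2 gives the mass, mean and
    second moment of the tilted entry. *)
Definition tilt (t : R) (a : nat) (z : R) : R := (1 + t * tail_sign u z) * z ^+ a.

Lemma measurable_tilt t a : measurable_fun setT (tilt t a).
Proof.
apply: measurable_funM; last exact: exprn_measurable.
apply: measurable_funD; first exact: measurable_cst.
by apply: measurable_funM; [exact: measurable_cst|exact: measurable_tail_sign].
Qed.

Lemma integrable_quadratic_growth (c : R) (h : R -> R) : measurable_fun setT h ->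
  (forall z, `|h z| <= c * (1 + z ^+ 2)) -> P.-integrable setT (EFin \o (h \o X)).
Proof.
move=> mh hc; have [_ iX2 _] := unit_variance_moments symX varX.
have i1 : P.-integrable setT (EFin \o (fun w => c * (1 + X w ^+ 2))).
  apply: (@integrableZl _ _ _ P setT measurableT c
    (EFin \o (fun w => 1 + X w ^+ 2))).
  apply: (@integrableD _ _ _ P setT measurableT
    (cst 1%:E) (EFin \o (fun w => X w ^+ 2))) => //.
  exact: finite_measure_integrable_cst.
apply: le_integrable i1 => //.
  by apply/measurable_EFinP; exact: measurableT_comp.
by move=> w _ /=; rewrite lee_fin (le_trans (hc _))// ler_norm.
Qed.

Lemma integrable_tilt t a : (a <= 2)%N ->
  P.-integrable setT (EFin \o (tilt t a \o X)).
Proof.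
move=> a2; apply: (@integrable_quadratic_growth (1 + `|t|)).
  exact: measurable_tilt.
move=> z; rewrite normrM; apply: ler_pM => //.
  rewrite (le_trans (ler_normD _ _))// normr1 lerD2l normrM.
  by rewrite ler_piMr// tail_sign_le1.
rewrite normrX; have z0 := normr_ge0 z.
rewrite -[z ^+ 2]real_normK ?num_real//.
case: a a2 => [|[|[|]]]// _; rewrite ?expr0 ?expr1.
- by rewrite lerDl sqr_ge0.
- by have := sqr_ge0 (`|z| - 1); rewrite !expr2; nra.
- by rewrite lerDr.
Qed.

Let g_int a : (a <= 2)%N ->
  P.-integrable setT (EFin \o (fun w => tail_sign u (X w) * X w ^+ a)).
Proof.
move=> a2; apply: (@integrable_quadratic_growth 1
   (fun z => tail_sign u z * z ^+ a)).
  by apply: measurable_funM; [exact: measurable_tail_sign|exact: exprn_measurable].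
move=> z; rewrite normrM normrX; have z0 := normr_ge0 z.
rewrite mul1r -[1 + _]mul1r; apply: ler_pM; rewrite ?exprn_ge0 ?tail_sign_le1//.
rewrite -[z ^+ 2]real_normK ?num_real//.
case: a a2 => [|[|[|]]]// _; rewrite ?expr0 ?expr1.
- by rewrite lerDl sqr_ge0.
- by have := sqr_ge0 (`|z| - 1); rewrite !expr2; nra.
- by rewrite lerDr.
Qed.

(** Equal to E |X| 1_{|X| > u}, the rate at which the tilt moves the mean. *)
Definition tail_moment : R := \int[P]_w (X w * tail_sign u (X w)).

Let pow_int a : (a <= 2)%N -> P.-integrable setT (EFin \o (fun w => X w ^+ a)).
Proof.
move=> a2; have := integrable_tilt 0 a2; congr integrable.
by apply/funext => w /=; rewrite /tilt mul0r addr0 mul1r.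
Qed.

Lemma Rintegral_tilt t a : (a <= 2)%N ->
  \int[P]_w tilt t a (X w) =
  \int[P]_w X w ^+ a + t * \int[P]_w (tail_sign u (X w) * X w ^+ a).
Proof.
move=> a2; rewrite -RintegralZl//; last exact: g_int.
rewrite -RintegralD//; first by apply: eq_Rintegral => w _; rewrite /tilt; ring.
- exact: pow_int.
- exact: (@integrableZl _ _ _ P setT measurableT t _ (g_int a2)).
Qed.

(** Each power of X meets the odd function [tail_sign], so symmetry kills the t-term for even powers
    and the untilted term for the first power. *)
Lemma tilt_moments t :
  [/\ \int[P]_w tilt t 0 (X w) = 1,
      \int[P]_w tilt t 1 (X w) = t * tail_moment &
      \int[P]_w tilt t 2 (X w) = 1].
Proof.
have [iX iX2 EX2] := unit_variance_moments symX varX.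
split; rewrite Rintegral_tilt//.
- rewrite (_ : (\int[P]_w (_ * _))%R = 0); last first.
    apply: (@symmetric_integral_odd _ _ _ P X (fun z => tail_sign u z * z ^+ 0)) => //.
    + by apply: measurable_funM; [exact: measurable_tail_sign|exact: exprn_measurable].
    + by move=> z; rewrite tail_signN !expr0; ring.
    + exact: g_int.
  rewrite mulr0 addr0; under eq_Rintegral do rewrite expr0.
  by rewrite Rintegral_cst// [X in fine X]probability_setT mul1r.
- rewrite (_ : (\int[P]_w (X w ^+ 1))%R = 0) ?add0r; last first.
    by apply: (@symmetric_integral_odd _ _ _ P X (fun z => z ^+ 1)).
  congr (_ * _); apply: eq_Rintegral => w _; ring.
- rewrite EX2 (_ : (\int[P]_w (_ * _))%R = 0) ?mulr0 ?addr0//.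
  apply: (@symmetric_integral_odd _ _ _ P X (fun z => tail_sign u z * z ^+ 2)) => //.
  + by apply: measurable_funM; [exact: measurable_tail_sign|exact: exprn_measurable].
  + by move=> z; rewrite tail_signN sqrrN; ring.
  + exact: g_int.
Qed.

Lemma integrable_tilt_sqr t :
  P.-integrable setT (EFin \o ((fun z => tilt t 0 z ^+ 2) \o X)).
Proof.
apply: (@integrable_quadratic_growth ((1 + `|t|) ^+ 2)).
  by apply: measurable_funX; exact: measurable_tilt.
move=> z; rewrite normrX -[leLHS]mulr1; apply: ler_pM; rewrite ?exprn_ge0//.
- rewrite ler_sqr ?nnegrE ?addr_ge0// /tilt expr0 mulr1.
  rewrite (le_trans (ler_normD _ _))// normr1 lerD2l normrM.
  by rewrite ler_piMr// tail_sign_le1.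
- by rewrite lerDl sqr_ge0.
Qed.

Lemma tilt_sqr_moment t : \int[P]_w tilt t 0 (X w) ^+ 2 <= 1 + t ^+ 2.
Proof.
have [E0 _ _] := tilt_moments t.
(* With |g| <= 1 for the tail sign g, (1 + t g)^2 <= 2 (1 + t g) + t^2 - 1 pointwise, and the tilt
   has integral 1. *)
have -> : 1 + t ^+ 2 = \int[P]_w (2 * tilt t 0 (X w) + (t ^+ 2 - 1)).
  rewrite RintegralD//; first last.
  - exact: finite_measure_integrable_cst.
  - exact: (@integrableZl _ _ _ P setT measurableT 2 _ (integrable_tilt t _)).
  rewrite RintegralZl//; last exact: integrable_tilt.
  rewrite E0 Rintegral_cst// [X in _ * fine X]probability_setT /=; ring.
apply: le_Rintegral => //.
- exact: integrable_tilt_sqr.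
- apply: (@integrableD _ _ _ P setT measurableT
    (EFin \o (fun w => 2 * tilt t 0 (X w))) (cst (t ^+ 2 - 1)%:E)) => //.
  + exact: (@integrableZl _ _ _ P setT measurableT 2 _ (integrable_tilt t _)).
  + exact: finite_measure_integrable_cst.
move=> w _; rewrite /tilt expr0 mulr1.
have := tail_sign_le1 (X w) u0; rewrite -ler_sqr ?nnegrE// expr1n.
rewrite real_normK ?num_real// => g1.
have := ler_wpM2l (sqr_ge0 t) g1; rewrite -exprMn mulr1.
by move: (t * tail_sign u (X w)) => y; rewrite !expr2; lra.
Qed.

Hypothesis smallX : (P [set w | (`|X w| <= u)%R] <= v%:E)%E.

Lemma tail_moment_ge : u * (1 - v) <= tail_moment.
Proof.
pose A : set T := [set w | `|X w| <= u].
have mA : measurable A.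
  rewrite -[A]setTI; apply: measurable_fun_le => //.
  exact: measurableT_comp (@normr_measurable _ _) _.
have iA : P.-integrable setT (EFin \o (fun w => u * (1 - \1_A w))).
  apply: (@integrableZl _ _ _ P setT measurableT u (EFin \o (fun w => 1 - \1_A w))).
  apply: (@integrableB _ _ _ P setT measurableT (cst 1%:E) (EFin \o \1_A)).
    exact: finite_measure_integrable_cst.
  exact: integrable_indic.
have PA : P A = (fine (P A))%:E by rewrite fineK// fin_num_measure.
have -> : u * (1 - v) = u * (1 - fine (P A)) - u * (v - fine (P A)) by ring.
apply: (@le_trans _ _ (u * (1 - fine (P A)))).
  rewrite gerBl; apply: mulr_ge0; first exact: ltW.
  by rewrite subr_ge0 -lee_fin -PA.
have <- : \int[P]_w (u * (1 - \1_A w)) = u * (1 - fine (P A)).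
  rewrite RintegralZl//; last first.
    apply: (@integrableB _ _ _ P setT measurableT (cst 1%:E) (EFin \o \1_A)).
      exact: finite_measure_integrable_cst.
    exact: integrable_indic.
  rewrite RintegralB//; first last.
  - exact: integrable_indic.
  - exact: finite_measure_integrable_cst.
  rewrite Rintegral_cst// [X in fine X]probability_setT mul1r.
  by rewrite /Rintegral integral_indic// setIT.
apply: le_Rintegral => //.
  rewrite (_ : _ \o _ = EFin \o (fun w => tail_sign u (X w) * X w ^+ 1)).
    exact: g_int.
  by apply/funext => w /=; rewrite expr1 mulrC.
move=> w _; rewrite mul_tail_sign// indicE.
have [wA|wA] := boolP (w \in A).
  by rewrite subrr mulr0 mulr_ge0.
have uX : u < `|X w| by rewrite ltNge; apply: contra wA => wA; rewrite inE.
by rewrite uX subr0 !mulr1 ltW.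
Qed.

End tilted_moments.

(** * The tilted sum and its small ball bound *)

Section small_ball.
Context {d : measure_display} {T : measurableType d} {R : realType}.
Variable P : probability T R.

Lemma Rintegral_sum (J : Type) (s : seq J) (f : J -> T -> R) :
  (forall j, P.-integrable setT (EFin \o f j)) ->
  P.-integrable setT (EFin \o (fun w => \sum_(j <- s) f j w)) /\
  \int[P]_w (\sum_(j <- s) f j w) = \sum_(j <- s) \int[P]_w f j w.
Proof.
move=> intf; elim: s => [|j s [iIH EIH]].
  rewrite (_ : (fun w => \sum_(j <- [::]) f j w) = cst 0); last first.
    by apply/funext => w; rewrite big_nil.
  rewrite big_nil Rintegral_cst// mul0r; split => //.
  exact: finite_measure_integrable_cst.
rewrite (_ : (fun w => \sum_(i <- j :: s) f i w) =
    (fun w => f j w + \sum_(i <- s) f i w)); last first.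
  by apply/funext => w; rewrite big_cons.
split.
  exact: (@integrableD _ _ _ P setT measurableT (EFin \o f j)
    (EFin \o (fun w => \sum_(i <- s) f i w))).
by rewrite big_cons -EIH RintegralD.
Qed.

Context {I : finType}.
Variables (u v : R) (X : I -> {RV P >-> R}).
Hypothesis (u0 : 0 < u) (v01 : 0 < v < 1).
Hypothesis indX : mutually_independent X.
Hypothesis symX : forall i, symmetric_rv P (X i).
Hypothesis varX : forall i, 'V_P[X i] = 1%E.
Hypothesis smallX : forall i, (P [set w | (`|X i w| <= u)%R] <= v%:E)%E.

Variables (x y : I -> R) (k : R).
Hypothesis x1 : forall i, `|x i| <= 1.
Hypothesis xk : \sum_i x i ^+ 2 <= k.

Let H := \sum_i x i * y i.
Hypothesis H0 : 0 < H.
Hypothesis yH : \sum_i y i ^+ 2 <= H ^+ 2.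

(** Dividing by [alpha i] makes the tilted mean of X_i exactly [beta * x i], whatever its law. As
    [beta] is half the lower bound on [alpha], |t i| <= |x i| / 2 <= 1/2, which keeps D nonnegative
    and produces the k/4 in the bound on E D^2. *)
Let beta := u * (1 - v) / 2.
Let alpha i := tail_moment u (X i).
Let t i := beta * x i / alpha i.

Let beta0 : 0 < beta.
Proof. by case/andP: v01 => _ v1; rewrite /beta divr_gt0// mulr_gt0// subr_gt0. Qed.

Let alpha_ge i : 2 * beta <= alpha i.
Proof.
by rewrite (_ : 2 * beta = u * (1 - v)) ?tail_moment_ge// /beta mulrC divfK.
Qed.

Let alpha0 i : 0 < alpha i.
Proof. by apply: lt_le_trans (alpha_ge i); rewrite mulr_gt0. Qed.

Let talpha i : t i * alpha i = beta * x i.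
Proof. by rewrite /t divfK// gt_eqF. Qed.

Let t_le i : `|t i| <= `|x i| / 2.
Proof.
rewrite /t normrM normfV (gtr0_norm (alpha0 i)) ler_pdivrMr// normrM gtr0_norm//.
by have := alpha_ge i; have := normr_ge0 (x i); nra.
Qed.

Let D w := \prod_i tilt u (t i) 0 (X i w).
Let S w := \sum_i y i * X i w.

Let D0 w : 0 <= D w.
Proof.
apply: prodr_ge0 => i _; rewrite /tilt expr0 mulr1.
have : `|t i * tail_sign u (X i w)| <= 1.
  rewrite normrM (le_trans (ler_pM _ _ (t_le i) (tail_sign_le1 _ u0)))//.
  by have := x1 i; lra.
by rewrite ler_norml; lra.
Qed.

(** By independence every mixed moment under D factors over the coordinates; exponents supported on
    at most two indices give E D, E D X_a and E D X_a X_b. *)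
Let prod_tilt (e : I -> nat) : (forall i, (e i <= 2)%N) ->
  P.-integrable setT (EFin \o (fun w => D w * \prod_i X i w ^+ e i)) /\
  \int[P]_w (D w * \prod_i X i w ^+ e i) =
  \prod_i \int[P]_w tilt u (t i) (e i) (X i w).
Proof.
move=> e2.
have -> : (fun w => D w * \prod_i X i w ^+ e i) =
    (fun w => \prod_i tilt u (t i) (e i) (X i w)).
  apply/funext => w; rewrite /D -big_split /=; apply: eq_bigr => i _.
  by rewrite /tilt expr0 mulr1.
apply: (independent_integral_prod indX (f := fun i => tilt u (t i) (e i))) => //.
- exact: index_enum_uniq.
- by move=> i; exact: measurable_tilt.
- by move=> i; exact: integrable_tilt.
Qed.

Let prod_pow1 (a : I) (z : I -> R) : \prod_i z i ^+ (i == a) = z a.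
Proof.
rewrite (bigD1 a)//= eqxx expr1 big1 ?mulr1// => i /negPf ->.
by rewrite expr0.
Qed.

Let prod_pow2 (a b : I) (z : I -> R) :
  \prod_i z i ^+ ((i == a) + (i == b)) = z a * z b.
Proof. by under eq_bigr do rewrite exprD; rewrite big_split /= !prod_pow1. Qed.

Let ED : P.-integrable setT (EFin \o D) /\ \int[P]_w D w = 1.
Proof.
have [] := prod_tilt (e := fun=> 0%N) (fun=> isT).
have -> : (fun w => D w * \prod_i X i w ^+ 0) = D.
  by apply/funext => w; rewrite big1 ?mulr1// => i _; rewrite expr0.
move=> iD ->; split => //; apply: big1 => i _.
by have [] := tilt_moments u0 (symX i) (varX i) (t i).
Qed.

Let EDX a : P.-integrable setT (EFin \o (fun w => D w * X a w)) /\
  \int[P]_w (D w * X a w) = beta * x a.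
Proof.
have e2 i : ((i == a : nat) <= 2)%N by case: (i == a).
have [] := prod_tilt e2.
have -> : (fun w => D w * \prod_i X i w ^+ (i == a)) = (fun w => D w * X a w).
  by apply/funext => w; rewrite prod_pow1.
move=> iD ->; split => //; rewrite (bigD1 a)//= eqxx big1 ?mulr1 => [|i /negPf ->].
  by have [_ -> _] := tilt_moments u0 (symX a) (varX a) (t a).
by have [] := tilt_moments u0 (symX i) (varX i) (t i).
Qed.

(** Under the tilted law the entries remain independent, with means [beta * x a] and second moments
    1. *)
Let EDXX a b : P.-integrable setT (EFin \o (fun w => D w * (X a w * X b w))) /\
  \int[P]_w (D w * (X a w * X b w)) =
  if a == b then 1 else beta ^+ 2 * (x a * x b).
Proof.
have e2 i : ((i == a) + (i == b) <= 2)%N by case: (i == a); case: (i == b).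
have [] := prod_tilt e2.
have -> : (fun w => D w * \prod_i X i w ^+ ((i == a) + (i == b))) =
    (fun w => D w * (X a w * X b w)).
  by apply/funext => w; rewrite prod_pow2.
move=> iD ->; split => //.
have E0 i : \int[P]_w tilt u (t i) 0 (X i w) = 1.
  by have [] := tilt_moments u0 (symX i) (varX i) (t i).
have E1 i (e : nat) : e = 1%N ->
    \int[P]_w tilt u (t i) e (X i w) = beta * x i.
  by move=> ->; have [_ -> _] := tilt_moments u0 (symX i) (varX i) (t i).
have E2 i : \int[P]_w tilt u (t i) 2 (X i w) = 1.
  by have [_ _ ->] := tilt_moments u0 (symX i) (varX i) (t i).
have [<-|ab] := eqVneq a b.
  by apply: big1 => i _; case: (i == a).
rewrite (bigD1 a)//= E1; last by rewrite eqxx; case: eqP ab.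
rewrite (bigD1 b) 1?eq_sym//= E1; last first.
  by move: ab; rewrite eqxx eq_sym; case: (b == a).
rewrite big1 ?mulr1 => [|i /andP[/negPf-> /negPf->]]; first ring.
exact: E0.
Qed.

Let m := beta * H.
Let m0 : 0 < m. Proof. exact: mulr_gt0. Qed.

Let EDS : P.-integrable setT (EFin \o (fun w => D w * S w)) /\
  \int[P]_w (D w * S w) = m.
Proof.
have int_a a : P.-integrable setT (EFin \o (fun w => y a * (D w * X a w))).
  apply: (@integrableZl _ _ _ P setT measurableT (y a) (EFin \o (fun w => D w * X a w))).
  by have [] := EDX a.
have [] := Rintegral_sum (index_enum I) int_a.
have -> : (fun w => \sum_a y a * (D w * X a w)) = (fun w => D w * S w).
  by apply/funext => w; rewrite /S big_distrr /=; apply: eq_bigr => a _; ring.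
move=> iDS ->; split => //; rewrite /m /H big_distrr /=.
apply: eq_bigr => a _; have [iDX EDXa] := EDX a.
by rewrite RintegralZl// EDXa; ring.
Qed.

Let EDS2 : P.-integrable setT (EFin \o (fun w => D w * S w ^+ 2)) /\
  \int[P]_w (D w * S w ^+ 2) <= H ^+ 2 + m ^+ 2.
Proof.
pose f (ab : I * I) w := y ab.1 * y ab.2 * (D w * (X ab.1 w * X ab.2 w)).
have intf ab : P.-integrable setT (EFin \o f ab).
  apply: (@integrableZl _ _ _ P setT measurableT (y ab.1 * y ab.2)
    (EFin \o (fun w => D w * (X ab.1 w * X ab.2 w)))).
  by have [] := EDXX ab.1 ab.2.
have [] := Rintegral_sum (index_enum (I * I)%type) intf.
have -> : (fun w => \sum_ab f ab w) = (fun w => D w * S w ^+ 2).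
  apply/funext => w; rewrite -(pair_bigA _ (fun a b => f (a, b) w)) /=.
  rewrite expr2 /S big_distrlr big_distrr /=; apply: eq_bigr => a _.
  by rewrite big_distrr /=; apply: eq_bigr => b _; rewrite /f /=; ring.
move=> iDS ->; split => //.
rewrite -(pair_bigA _ (fun a b => \int[P]_w f (a, b) w)) /=.
(* On the diagonal a nonnegative term (beta x_a y_a)^2 is added, so that the first double sum
   completes to the square m^2. *)
have fE a b : \int[P]_w f (a, b) w <=
    y a * y b * (beta ^+ 2 * (x a * x b)) + (if a == b then y a ^+ 2 else 0).
  have [iab Eab] := EDXX a b.
  rewrite /f RintegralZl// Eab; case: eqP => [<-|_]; last by rewrite addr0.
  have : 0 <= (y a * beta * x a) ^+ 2 by exact: sqr_ge0.
  by rewrite !expr2; lra.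
apply: (@le_trans _ _ (\sum_a \sum_b (y a * y b * (beta ^+ 2 * (x a * x b)) +
    (if a == b then y a ^+ 2 else 0)))).
  by apply: ler_sum => a _; apply: ler_sum => b _; exact: fE.
have -> : \sum_a \sum_b (y a * y b * (beta ^+ 2 * (x a * x b)) +
    (if a == b then y a ^+ 2 else 0)) = m ^+ 2 + \sum_a y a ^+ 2.
  under eq_bigr do rewrite big_split /=.
  rewrite big_split /=; congr (_ + _).
    rewrite (_ : m ^+ 2 = beta ^+ 2 * (H * H)); last by rewrite /m; ring.
    rewrite /H big_distrlr big_distrr /=.
    apply: eq_bigr => a _; rewrite big_distrr /=.
    by apply: eq_bigr => b _; ring.
  apply: eq_bigr => a _; rewrite (bigD1 a)//= eqxx big1 ?addr0// => b.
  by rewrite eq_sym => /negPf ->.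
by rewrite addrC lerD2r.
Qed.

(** Each factor contributes at most 1 + t_i^2 <= exp(x_i^2 / 4), and the squares of the x_i sum to
    at most k. *)
Let ED2 : P.-integrable setT (EFin \o (fun w => D w ^+ 2)) /\
  \int[P]_w D w ^+ 2 <= expR (k / 4).
Proof.
have [] := independent_integral_prod indX (index_enum_uniq I)
  (f := fun i z => tilt u (t i) 0 z ^+ 2).
- by move=> i; apply: measurable_funX; exact: measurable_tilt.
- by move=> i; exact: integrable_tilt_sqr.
have -> : (fun w => \prod_i tilt u (t i) 0 (X i w) ^+ 2) = (fun w => D w ^+ 2).
  by apply/funext => w; rewrite prodrXl.
move=> iD ->; split => //.
apply: (@le_trans _ _ (\prod_i expR (x i ^+ 2 / 4))); last first.
  rewrite -expR_sum ler_expR -mulr_suml ler_pM2r ?invr_gt0//.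
apply: ler_prod => i _; apply/andP; split.
  by apply: Rintegral_ge0 => w _; exact: sqr_ge0.
apply: le_trans (tilt_sqr_moment u0 (symX i) (varX i) (t i)) _.
apply: le_trans (expR_ge1Dx _); rewrite lerD2l.
have := t_le i; rewrite -ler_sqr ?nnegrE ?divr_ge0//.
by rewrite expr_div_n !real_normK ?num_real// -natrX.
Qed.

(* Change of measure: under the density D the sum S has mean m and second
   moment O(m^2), while D has second moment at most exp(k/4); both
   Cauchy-Schwarz steps are replaced by pointwise AM-GM inequalities. *)
Lemma small_ball_lower_bound :
  ((expR (- (k / 4)) / (16 * (1 + (beta ^+ 2)^-1) ^+ 2))%:E <=
   P [set w | (m / 2 < S w)%R])%E.
Proof.
set kappa := 1 + (beta ^+ 2)^-1.
have k1 : 0 < kappa by rewrite addr_gt0// invr_gt0 exprn_gt0.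
pose A : set T := [set w | (m / 2 < S w)%R].
have [iD E1] := ED; have [iDS E2] := EDS; have [iDS2 E3] := EDS2.
have [iD2 E4] := ED2.
have mS : measurable_fun setT S.
  have -> : S = \sum_i (fun w => y i * X i w).
    by apply/funext => w; rewrite fct_sumE.
  apply: big_ind => [|f g mf mg|i _].
  - exact: measurable_cst.
  - exact: measurable_funD.
  - by apply: measurable_funM => //; exact: measurable_cst.
have mA : measurable A.
  rewrite (_ : A = ~` (setT `&` [set w | S w <= m / 2])).
    apply: measurableC; apply: measurable_fun_le => //; exact: measurable_cst.
  by rewrite setTI; apply/seteqP; split=> w /=; rewrite /A /= ltNge => /negP.
set p := fine (P A); have PA : P A = p%:E by rewrite fineK// fin_num_measure.
pose E := expR (k / 4); have E0 : 0 < E by exact: expR_gt0.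
(* Weights for the two AM-GM steps. Since E D S^2 <= m^2 kappa, the first three terms of the bound
   integrate to at most m/2, m/4 and m/8; the remaining m/8 must come from A, whose term is 2 m
   kappa^2 E p. *)
pose a := (4 * m * kappa)^-1; pose b := (8 * kappa * E)^-1.
have m4 : 0 < 4 * m by apply: mulr_gt0.
have k8 : 0 < 8 * kappa by apply: mulr_gt0.
have a0 : 0 < a by rewrite invr_gt0; exact: mulr_gt0 m4 k1.
have b0 : 0 < b by rewrite invr_gt0; exact: mulr_gt0 k8 E0.
have a4 : 0 < 4 * a by apply: mulr_gt0.
have m2 : 0 < m / 2 by apply: divr_gt0.
have pointwise w : D w * S w <= m / 2 * D w + (a * (D w * S w ^+ 2) +
    (b / (4 * a) * D w ^+ 2 + (16 * a * b)^-1 * \1_A w)).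
  have Dw := D0 w.
  have aD : 0 <= a * (D w * S w ^+ 2).
    by apply: mulr_ge0 (ltW a0) _; apply: mulr_ge0 Dw (sqr_ge0 _).
  have bD : 0 <= b / (4 * a) * D w ^+ 2.
    by apply: mulr_ge0 (sqr_ge0 _); apply: ltW; exact: divr_gt0.
  rewrite indicE; have [wA|wA] := boolP (w \in A); last first.
    have Sm : S w <= m / 2 by rewrite leNgt; apply: contra wA => wA; rewrite inE.
    have := ler_wpM2l Dw Sm.
    by rewrite mulr0; lra.
  have mD : 0 <= m / 2 * D w by rewrite mulr_ge0// ltW.
  (* On A: S <= a S^2 + 1/(4a) is multiplied by D, and then D <= b D^2 + 1/(4b). *)
  apply: (@le_trans _ _ (a * (D w * S w ^+ 2) + D w / (4 * a))).
    have := mulr_ge0 Dw (mulr_ge0 (ltW a0) (sqr_ge0 (S w - (2 * a)^-1))).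
    rewrite [X in 0 <= X -> _](_ : _ =
      a * (D w * S w ^+ 2) + D w / (4 * a) - D w * S w) ?subr_ge0//.
    by field; rewrite gt_eqF.
  suff : D w / (4 * a) <= b / (4 * a) * D w ^+ 2 + (16 * a * b)^-1.
    by rewrite mulr1; lra.
  have := mulr_ge0 (ltW b0) (sqr_ge0 (D w - (2 * b)^-1)).
  have a4' : 0 <= (4 * a)^-1 by rewrite invr_ge0 ltW.
  move/(mulr_ge0 a4'); rewrite [X in 0 <= X -> _](_ : _ =
      b / (4 * a) * D w ^+ 2 + (16 * a * b)^-1 - D w / (4 * a)) ?subr_ge0//.
  by field; rewrite !gt_eqF.
have intZ (c : R) (f : T -> R) : P.-integrable setT (EFin \o f) ->
    P.-integrable setT (EFin \o (fun w => c * f w)).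
  exact: (@integrableZl _ _ _ P setT measurableT c (EFin \o f)).
have intD (f g : T -> R) : P.-integrable setT (EFin \o f) ->
    P.-integrable setT (EFin \o g) ->
    P.-integrable setT (EFin \o (fun w => f w + g w)).
  exact: (@integrableD _ _ _ P setT measurableT (EFin \o f) (EFin \o g)).
have i1 : P.-integrable setT (EFin \o \1_A) by exact: integrable_indic.
have i2 := intD _ _ (intZ (b / (4 * a)) _ iD2) (intZ ((16 * a * b)^-1) _ i1).
have i3 := intD _ _ (intZ a _ iDS2) i2.
have i4 := intD _ _ (intZ (m / 2) _ iD) i3.
have := le_Rintegral measurableT iDS i4 (fun w _ => pointwise w).
rewrite E2 !RintegralD//; try exact: intZ.
rewrite !RintegralZl// E1 mulr1.
rewrite [X in _ + (_ + (_ + _ * X))](_ : _ = p); last first.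
  by rewrite /Rintegral integral_indic// setIT.
move=> ineq.
have {ineq} : m <= m / 2 + (a * (H ^+ 2 + m ^+ 2) +
    (b / (4 * a) * E + (16 * a * b)^-1 * p)).
  apply: le_trans ineq _; rewrite lerD2l lerD//; first by rewrite ler_pM2l.
  by rewrite lerD2r ler_pM2l// divr_gt0.
have -> : H ^+ 2 + m ^+ 2 = m ^+ 2 * kappa.
  by rewrite /kappa /m; field; rewrite gt_eqF.
rewrite (_ : m / 2 + _ = m * (3 / 4 + 1 / 8 + 2 * kappa ^+ 2 * E * p)); last first.
  by rewrite /a /b; field; rewrite !gt_eqF.
rewrite -[X in X <= _]mulr1 ler_pM2l// => ineq.
rewrite PA lee_fin ler_pdivrMr ?mulr_gt0 ?exprn_gt0// expRN -/E.
by rewrite -(ler_pM2r E0) mulVf ?gt_eqF//; lra.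
Qed.

End small_ball.

(** * Duality and vertices *)

Section polar_duality.
Context {R : realType}.

Let continuous_sum (T : topologicalType) (J : finType) (f : J -> T -> R) :
  (forall j, continuous (f j)) -> continuous (fun x => \sum_j f j x).
Proof.
move=> cf; rewrite (_ : (fun x => _) = \sum_j f j); last first.
  by apply/funext => x; rewrite fct_sumE.
apply: (big_ind (fun g : T -> R => continuous g)) => [x|g h cg ch x|j _].
- exact: cvg_cst.
- by apply: continuousD; [exact: cg|exact: ch].
- exact: cf.
Qed.

Lemma compact_l1_ball N : compact [set q : 'rV[R]_N | \sum_i `|q 0 i| <= 1].
Proof.
apply: (@subclosed_compact _ _ [set q : 'rV[R]_N | forall i, `[-1, 1]%classic (q ord0 i)]).
- rewrite (_ : mkset _ = (fun q : 'rV[R]_N => \sum_i `|q 0 i|) @^-1` [set x | x <= 1])//.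
  apply: preimage_closed; last exact: closed_le.
  move=> q _.
  apply: (@continuous_sum 'rV[R]_N 'I_N (fun i q => `|q 0 i|)) => i {}q.
  apply: (@continuous_comp 'rV[R]_N R R (fun q => q 0 i) Num.norm).
    exact: coord_continuous.
  exact: norm_continuous.
- exact: (@rV_compact R N (fun=> `[-1, 1]%classic) (fun=> @segment_compact _ _ _)).
- move=> q /= q1 i; rewrite in_itv/= -ler_norml (le_trans _ q1)//.
  by rewrite (bigD1 i)//= lerDl sumr_ge0.
Qed.

(* The separating direction y is the difference between x and the point of
   the (compact, convex) image of the l1-ball that is closest to x. *)
Lemma l1_ball_image_separation N n (A : 'M[R]_(N, n)) (x : 'rV[R]_n) :
  (exists2 q : 'rV[R]_N, \sum_i `|q 0 i| <= 1 & q *m A = x) \/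
  (exists y : 'cV[R]_n, forall i, `|(A *m y) i 0| < (x *m y) 0 0).
Proof.
pose K := [set q : 'rV[R]_N | \sum_i `|q 0 i| <= 1].
pose f (q : 'rV[R]_N) := \sum_j ((q *m A - x) 0 j) ^+ 2.
have K0 : K !=set0.
  by exists 0; rewrite /K /= big1// => i _; rewrite mxE normr0.
have cf : continuous f.
  apply: (@continuous_sum 'rV[R]_N 'I_n (fun j q => ((q *m A - x) 0 j) ^+ 2)) => j q.
  have cj : continuous (fun q : 'rV[R]_N => (q *m A - x) 0 j).
    rewrite (_ : (fun q => _) = (fun q : 'rV[R]_N => \sum_i q 0 i * A i j - x 0 j)).
      move=> p; apply: (@continuousB _ _ _ (fun q : 'rV[R]_N => \sum_i q 0 i * A i j)
        (cst (x 0 j))); last exact: cst_continuous.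
      apply: (@continuous_sum 'rV[R]_N 'I_N (fun i q => q 0 i * A i j)) => i {}p.
      apply: (@continuousM _ _ (fun q : 'rV[R]_N => q 0 i) (cst (A i j))).
        exact: coord_continuous.
      exact: cst_continuous.
    by apply/funext => p; rewrite !mxE.
  rewrite (_ : (fun q => _) = (fun q : 'rV[R]_N =>
    (q *m A - x) 0 j * (q *m A - x) 0 j)); last by apply/funext => p; rewrite expr2.
  by apply: continuousM; exact: cj.
have [q0 /set_mem q0K q0min] := compact_EVT_min K0 (@compact_l1_ball N)
  (continuous_subspaceT cf).
pose y := (x - q0 *m A)^T.
have [y0|yN0] := eqVneq y 0.
  left; exists q0 => //; apply/eqP; rewrite eq_sym -subr_eq0.
  by move/(congr1 trmx) : y0; rewrite trmxK trmx0 => ->.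
right; exists y.
have yy : 0 < \sum_j y j 0 ^+ 2.
  rewrite lt0r sumr_ge0 ?andbT => [|j _]; last exact: sqr_ge0.
  apply: contra yN0; rewrite psumr_eq0 => [/allP yj|j _]; last exact: sqr_ge0.
  apply/eqP/colP => j; rewrite [RHS]mxE; apply/eqP.
  by have := yj j (mem_index_enum _); rewrite /= sqrf_eq0.
have key q : K q -> (q *m A *m y) 0 0 <= (q0 *m A *m y) 0 0.
  move=> Kq; pose r := (q - q0) *m A.
  pose a := (r *m y) 0 0; pose b := \sum_j r 0 j ^+ 2.
  suff : a <= 0 by rewrite /a /r !mulmxBl !mxE subr_le0.
  have b0 : 0 <= b by apply: sumr_ge0 => j _; exact: sqr_ge0.
  (* First-order optimality of q0: moving by t towards q changes the squared distance by -2ta + t^2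
     b, which cannot be negative. *)
  have tP t : 0 < t <= 1 -> 2 * a <= t * b.
    move=> /andP[t0 t1].
    have Kt : K (q0 + t *: (q - q0)).
      rewrite /K /=; apply: (@le_trans _ _ ((1 - t) * 1 + t * 1)); last by lra.
      apply: (@le_trans _ _ ((1 - t) * \sum_i `|q0 0 i| + t * \sum_i `|q 0 i|)).
        rewrite !mulr_sumr -big_split /=; apply: ler_sum => i _; rewrite !mxE.
        rewrite (_ : q0 0 i + _ = (1 - t) * q0 0 i + t * q 0 i); last ring.
        rewrite (le_trans (ler_normD _ _))// !normrM (gtr0_norm t0).
        by rewrite [`|1 - t|]ger0_norm// subr_ge0.
      apply: lerD; apply: ler_wpM2l; [by rewrite subr_ge0|exact: q0K|exact: ltW|].
      exact: Kq.
    have := q0min _ (mem_set Kt).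
    rewrite [X in _ <= X -> _](_ : _ = f q0 - 2 * t * a + t ^+ 2 * b).
      rewrite -addrA lerDl => h; rewrite -(ler_pM2l t0).
      by move: h; rewrite expr2; lra.
    rewrite /f /a /b mxE !mulr_sumr -sumrN -!big_split /=.
    apply: eq_bigr => j _; rewrite mulmxDl -scalemxAl -/r !mxE.
    ring.
  rewrite leNgt; apply/negP => a0.
  (* If a > 0, this t satisfies t b <= a, against 2a <= t b. *)
  have := tP (Num.min 1 (a / (b + 1))).
  rewrite lt_min ltr01 divr_gt0 ?ltr_wpDl// ge_min lexx /= => /(_ isT).
  have : Num.min 1 (a / (b + 1)) * b <= a / (b + 1) * b.
    by rewrite ler_wpM2r// ge_min lexx orbT.
  have : a / (b + 1) * b <= a.
    by rewrite mulrAC ler_pdivrMr ?ltr_wpDl//; nra.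
  by lra.
have xy : (x *m y) 0 0 = (q0 *m A *m y) 0 0 + \sum_j y j 0 ^+ 2.
  rewrite !mxE -big_split /=; apply: eq_bigr => j _; rewrite !mxE; ring.
(* Testing [key] at the vertices of the l1-ball, with both signs, bounds each |(A y)_i| by q0 A y,
   which x.y exceeds by |y|_2^2 > 0. *)
have Ke (e : R) i : `|e| <= 1 -> K (e *: delta_mx 0 i).
  move=> e1; rewrite /K /= (bigD1 i)//= big1 => [|k ki].
    by rewrite !mxE !eqxx mulr1 addr0.
  by rewrite !mxE (negPf ki) andbF mulr0 normr0.
move=> i; have e_i e : (e *: delta_mx 0 i *m A *m y) 0 0 = e * (A *m y) i 0.
  rewrite -mulmxA [LHS]mxE (bigD1 i)//= big1 => [|k ki].
    by rewrite addr0; congr (_ * _); rewrite !mxE !eqxx mulr1.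
  by rewrite [X in X * _](_ : _ = 0) ?mul0r// !mxE (negPf ki) andbF mulr0.
have := key _ (Ke 1 i _); have := key _ (Ke (-1) i _).
rewrite normrN normr1 lexx !e_i => /(_ isT) h1 /(_ isT) h2.
by rewrite xy ltr_norml; apply/andP; split; lra.
Qed.

End polar_duality.

(** * Vertices of symmetric polyhedra *)

Section vertices.
Context {R : realType}.

(** Rows outside J are zeroed rather than deleted: the row space is that of the rows in J, and the
    matrix size does not vary with J. *)
Definition keep_rows m n (J : {set 'I_m}) (A : 'M[R]_(m, n)) : 'M[R]_(m, n) :=
  \matrix_(i, j) (if i \in J then A i j else 0).

Lemma row_keep_rows m n (J : {set 'I_m}) (A : 'M[R]_(m, n)) i :
  row i (keep_rows J A) = if i \in J then row i A else 0.
Proof. by apply/rowP => j; rewrite !mxE; case: ifP; rewrite !mxE. Qed.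

Lemma submx_keep_rows m n (J1 J2 : {set 'I_m}) (A : 'M[R]_(m, n)) :
  J1 \subset J2 -> (keep_rows J1 A <= keep_rows J2 A)%MS.
Proof.
move=> J12; apply/row_subP => i; rewrite row_keep_rows.
case: ifP => [iJ|_]; last exact: sub0mx.
have -> : row i A = row i (keep_rows J2 A).
  by rewrite row_keep_rows (fintype.subsetP J12 _ iJ).
exact: row_sub.
Qed.

(* One step of the simplex method: move along a direction orthogonal to all
   active constraints, not decreasing c, until a new constraint is active. *)
Lemma activate_constraint m n (A : 'M[R]_(m, n)) (s : 'I_m -> R)
    (c : 'rV[R]_n) (J : {set 'I_m}) (y : 'cV[R]_n) :
  row_full A -> (forall i, `|(A *m y) i 0| <= s i) ->
  (forall i, i \in J -> `|(A *m y) i 0| = s i) -> ~~ row_full (keep_rows J A) ->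
  exists (J' : {set 'I_m}) (y' : 'cV[R]_n),
    [/\ forall i, `|(A *m y') i 0| <= s i,
        forall i, i \in J' -> `|(A *m y') i 0| = s i,
        (c *m y) 0 0 <= (c *m y') 0 0 &
        (\rank (keep_rows J A) < \rank (keep_rows J' A))%N].
Proof.
move=> fullA feas actJ nfull; set AJ := keep_rows J A.
have [z [z0 AJz cz]] : exists z : 'cV[R]_n,
    [/\ z != 0, AJ *m z = 0 & 0 <= (c *m z) 0 0].
  have : cokermx AJ != 0 by rewrite cokermx_eq0.
  case/matrix0Pn => i [j ijN0]; pose z := col j (cokermx AJ).
  have z0 : z != 0 by apply/matrix0Pn; exists i, 0; rewrite mxE.
  have AJz : AJ *m z = 0 by rewrite /z colE mulmxA mulmx_coker mul0mx.
  have [cz|/ltW cz] := leP 0 ((c *m z) 0 0); first by exists z.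
  exists (- z); rewrite oppr_eq0 mulmxN AJz oppr0; split => //.
  by rewrite mulmxN mxE oppr_ge0.
(* Full column rank guarantees that some constraint varies along z and stops the motion. *)
have Az0 : A *m z != 0.
  apply: contra z0 => /eqP Az; case/row_fullP : fullA => B BA.
  by rewrite -[z]mul1mx -BA -mulmxA Az mulmx0.
have AzJ i : i \in J -> (A *m z) i 0 = 0.
  move=> iJ; have := congr1 (fun M : 'cV[R]_m => M i 0) AJz; rewrite mxE [in RHS]mxE => <-.
  by rewrite mxE; apply: eq_bigr => j _; rewrite mxE iJ.
case/matrix0Pn : Az0 => i1 [k]; rewrite ord1 => {k} Azi1.
(* The step length at which constraint i becomes tight when moving along z; the smallest one keeps
   all constraints satisfied. *)
pose t i := (s i - Num.sg ((A *m z) i 0) * (A *m y) i 0) / `|(A *m z) i 0|.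
pose i0 := [arg min_(i < i1 | (A *m z) i 0 != 0) t i]%O.
have [Azi0 tmin] : (A *m z) i0 0 != 0 /\
    forall i, (A *m z) i 0 != 0 -> t i0 <= t i.
  by rewrite /i0; case: arg_minP => // i.
have s0 i : 0 <= s i by apply: le_trans (feas i).
have sg_le i : Num.sg ((A *m z) i 0) * (A *m y) i 0 <= s i.
  apply: le_trans (feas i); rewrite (le_trans (ler_norm _))// normrM.
  by rewrite normr_sg; case: eqP => _; rewrite ?mul0r ?mul1r.
have t0 : 0 <= t i0 by rewrite divr_ge0// subr_ge0.
exists (i0 |: J), (y + t i0 *: z).
have yE i : (A *m (y + t i0 *: z)) i 0 = (A *m y) i 0 + t i0 * (A *m z) i 0.
  by rewrite mulmxDr -scalemxAr !mxE.
split.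
- move=> i; rewrite yE; have [->|Azi] := eqVneq ((A *m z) i 0) 0.
    by rewrite mulr0 addr0.
  have := tmin i Azi; rewrite {2}/t ler_pdivlMr ?normr_gt0//.
  have := feas i; rewrite !ler_norml => /andP[].
  move: Azi; rewrite neq_lt => /orP[zi|zi].
    rewrite ltr0_sg// (ltr0_norm zi) => h1 h2 h3.
    have : t i0 * (A *m z) i 0 <= 0 by rewrite mulr_ge0_le0// ltW.
    by move=> h4; apply/andP; split; lra.
  rewrite gtr0_sg// (gtr0_norm zi) => h1 h2 h3.
  have : 0 <= t i0 * (A *m z) i 0 by rewrite mulr_ge0// ltW.
  by move=> h4; apply/andP; split; lra.
- move=> i; rewrite yE inE => /orP[|iJ]; last by rewrite AzJ// mulr0 addr0 actJ.
  rewrite inE => /eqP ->; rewrite /t.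
  move: Azi0; rewrite neq_lt => /orP[zi|zi].
    rewrite ltr0_sg// (ltr0_norm zi).
    rewrite [X in `|X|](_ : _ = - s i0) ?normrN ?ger0_norm//.
    move: zi; move: ((A *m z) i0 0) ((A *m y) i0 0) (s i0) => b a r b0.
    by rewrite invrN mulrN mulNr divfK ?lt_eqF//; ring.
  rewrite gtr0_sg// (gtr0_norm zi) [X in `|X|](_ : _ = s i0) ?ger0_norm//.
  move: zi; move: ((A *m z) i0 0) ((A *m y) i0 0) (s i0) => b a r b0.
  by rewrite divfK ?gt_eqF//; ring.
- by rewrite mulmxDr -scalemxAr [leRHS]mxE lerDl [leRHS]mxE mulr_ge0.
rewrite ltn_neqAle mxrankS ?andbT; last by apply: submx_keep_rows; exact: finset.subsetUr.
apply/negP => /eqP rkE.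
have sub : (keep_rows (i0 |: J) A <= AJ)%MS.
  have := mxrank_leqif_sup (submx_keep_rows A (finset.subsetUr [set i0] J)).
  by move=> [_]; rewrite rkE eqxx => <-.
(* If the rank did not grow, row i0 would be a combination of active rows; these annihilate z, while
   row i0 does not. *)
have : (row i0 A <= AJ)%MS.
  apply: submx_trans sub; rewrite (_ : row i0 A = row i0 (keep_rows (i0 |: J) A)).
    exact: row_sub.
  by rewrite row_keep_rows !inE eqxx.
case/submxP => B rowB; move/eqP : Azi0; apply.
have -> : (A *m z) i0 0 = (row i0 A *m z) 0 0 by rewrite -row_mul [RHS]mxE.
by rewrite rowB -mulmxA AJz mulmx0 mxE.
Qed.

(** Each activation raises the rank of the active rows, so n steps suffice. The functional c never
    decreases; with c = x^T the vertex inherits x.y >= 1. *)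
Lemma polyhedron_vertex m n (A : 'M[R]_(m, n)) (s : 'I_m -> R)
    (c : 'rV[R]_n) (y0 : 'cV[R]_n) :
  row_full A -> (forall i, `|(A *m y0) i 0| <= s i) ->
  exists (J : {set 'I_m}) (y : 'cV[R]_n),
    [/\ forall i, `|(A *m y) i 0| <= s i,
        forall i, i \in J -> `|(A *m y) i 0| = s i,
        (c *m y0) 0 0 <= (c *m y) 0 0 & row_full (keep_rows J A)].
Proof.
move=> fullA feas0.
suff H k : forall (J : {set 'I_m}) (y : 'cV[R]_n),
    (n - \rank (keep_rows J A) <= k)%N ->
    (forall i, `|(A *m y) i 0| <= s i) ->
    (forall i, i \in J -> `|(A *m y) i 0| = s i) ->
    (c *m y0) 0 0 <= (c *m y) 0 0 ->
    exists (J : {set 'I_m}) (y : 'cV[R]_n),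
    [/\ forall i, `|(A *m y) i 0| <= s i,
        forall i, i \in J -> `|(A *m y) i 0| = s i,
        (c *m y0) 0 0 <= (c *m y) 0 0 & row_full (keep_rows J A)].
  by apply: (H n finset.set0 y0) => //; [exact: leq_subr|move=> i; rewrite inE].
elim: k => [|k IH] J y rk feas act cy.
  exists J, y; split => //; rewrite /row_full eqn_leq rank_leq_col/=.
  by rewrite -subn_eq0 -leqn0.
have [full|nfull] := boolP (row_full (keep_rows J A)); first by exists J, y.
have [J' [y' [feas' act' cy' rk']]] := activate_constraint c fullA feas act nfull.
apply: (IH J' y') => //; last exact: le_trans cy'.
by rewrite -ltnS; apply: leq_trans rk; rewrite ltn_sub2l// (leq_trans rk')// rank_leq_col.
Qed.

(** Listing the selected rows by [enum K] makes the linear system depend only on the set K, so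
    candidates are counted by a binomial coefficient. *)
Lemma vertex_basis m n (A : 'M[R]_(m, n)) (J : {set 'I_m}) :
  row_full (keep_rows J A) ->
  exists K : {set 'I_m}, [/\ K \subset J, #|K| = n &
    forall i0, rowsub (fun k : 'I_n => nth i0 (enum K) k) A \in unitmx].
Proof.
move=> fullJ; pose f := fullrankfun fullJ.
have f_inj : injective f by exact: fullrankfun_inj.
have f_unit : rowsub f (keep_rows J A) \in unitmx by exact: fullrowsub_unit.
have fJ k : f k \in J.
  apply/negPn/negP => fk.
  have /(congr1 (fun M : 'M[R]_n => M k k)) := mulmxV f_unit.
  rewrite !mxE eqxx big1 => [/eqP|l _]; first by rewrite eq_sym oner_eq0.
  by rewrite !mxE (negPf fk) mul0r.
have fA_unit : rowsub f A \in unitmx.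
  suff -> : rowsub f A = rowsub f (keep_rows J A) by [].
  by apply/matrixP => k l; rewrite !mxE fJ.
have cardK : #|f @: 'I_n| = n by rewrite card_imset// card_ord.
exists (f @: 'I_n)%SET; split => //.
  by apply/fintype.subsetP => _ /imsetP[k _ ->].
move=> i0; set e := fun k : 'I_n => _.
rewrite -row_full_unit -col_leq_rank.
rewrite -[X in (X <= _)%N](mxrank_unit fA_unit); apply: mxrankS.
apply/row_subP => k; have fkK : f k \in enum (f @: 'I_n)%SET.
  by rewrite mem_enum imset_f.
have lt_k : (index (f k) (enum (f @: 'I_n)%SET) < n)%N.
  by rewrite -[X in (_ < X)%N]cardK cardE index_mem.
rewrite (_ : row k (rowsub f A) = row (Ordinal lt_k) (rowsub e A)) ?row_sub//.
by apply/rowP => j; rewrite !mxE /e /= nth_index.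
Qed.

End vertices.

(** * Union bound over vertices *)

Section finite_bounds.
Context {d : measure_display} {T : measurableType d} {R : realType}.
Variable P : probability T R.

Lemma union_bound (Q : finType) (p : pred Q) (D : Q -> set T) (E : set T)
    (e : R) :
  measurable E -> (forall q, p q -> measurable (D q) /\ (P (D q) <= e%:E)%E) ->
  (forall w, E w -> exists q, p q /\ D q w) -> (P E <= (e *+ #|p|)%:E)%E.
Proof.
move=> mE DP ED; rewrite cardE.
have [mU PU] : let U := \big[setU/set0]_(q <- enum p) D q in
    measurable U /\ (P U <= (e *+ size (enum p))%:E)%E.
  have : {in enum p, forall q, p q} by move=> q; rewrite mem_enum.
  elim: (enum p) => [|q s IH] ps /=.
    by rewrite big_nil; split => //; rewrite measure0 mulr0n.
  have [|mU PU] := IH; first by move=> r rs; apply: ps; rewrite inE rs orbT.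
  have [mD PD] := DP q (ps q (mem_head _ _)).
  rewrite big_cons; split; first exact: measurableU.
  apply: le_trans (measureU2 _ mD mU) _.
  by rewrite mulrS EFinD leeD.
apply: le_trans PU; apply: le_measure; rewrite ?inE// => w /ED[q [pq Dq]].
rewrite -bigcup_seq; exists q => //=; by rewrite mem_enum.
Qed.

End finite_bounds.

(** * Number of candidates against the small ball probability *)

Section counting.
Context {R : realType}.

(** In k + 4, k + 2 pays for the binomial coefficient, 1 for the signs and 1 for the final
    exp(-n). *)
Lemma half_exp_ge (k : R) : 16 <= k -> k + 4 <= expR (k / 2) / 2.
Proof.
move=> k16; have -> : k / 2 = 4%:R * (k / 8) by field.
rewrite expRM_natl; set z := k / 8.
have z2 : 2 <= z by rewrite ler_pdivlMr//; lra.
have -> : k = 8 * z by rewrite /z; field.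
have h : 1 + z <= expR z by exact: expR_ge1Dx.
have h4 : (1 + z) ^+ 4 <= expR z ^+ 4 by rewrite lerXn2r ?nnegrE ?expR_ge0//; lra.
have h3 : 3 ^+ 3 <= (1 + z) ^+ 3 :> R by rewrite lerXn2r ?nnegrE ?expR_ge0//; lra.
have : (1 + z) * 3 ^+ 3 <= (1 + z) ^+ 4.
  by rewrite [(1 + z) ^+ 4]exprS ler_wpM2l//; lra.
by rewrite -natrX; lra.
Qed.

(** With t = n/N = e^(-k), C(N + n, n) t^n is one term of (1 + t)^(N + n) <= exp(t (N + n)) <=
    exp(2n). *)
Lemma binomial_le_exp (n N : nat) (k : R) : N%:R = n%:R * expR k -> 0 <= k ->
  'C(N + n, n)%:R <= expR (n%:R * (k + 2)).
Proof.
move=> NE k0; set t := expR (- k).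
have t0 : 0 < t by exact: expR_gt0.
have t1 : t <= 1 by rewrite -[leRHS](@expR0 R) ler_expR oppr_le0.
have tN : t * N%:R = n%:R.
  by rewrite NE mulrCA -expRD addNr expR0 mulr1.
have : 'C(N + n, n)%:R * t ^+ n <= expR (2 * n%:R).
  apply: (@le_trans _ _ ((1 + t) ^+ (N + n))).
    rewrite exprDn (bigD1 (inord n : 'I_(N + n).+1))//= inordK ?ltnS ?leq_addl//.
    rewrite expr1n mul1r -[t ^+ n *+ _]mulr_natl lerDl sumr_ge0// => i _.
    by rewrite mulrn_wge0// mulr_ge0// exprn_ge0// ltW.
  apply: (@le_trans _ _ (expR t ^+ (N + n))).
    by rewrite lerXn2r ?nnegrE ?expR_ge0 ?expR_ge1Dx// addr_ge0// ltW.
  rewrite -expRM_natr ler_expR natrD mulrDr tN.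
  have : t * n%:R <= n%:R by rewrite ler_piMl.
  by lra.
rewrite /t -expRM_natl mulrN expRN ler_pdivrMr ?expR_gt0// -expRD.
by rewrite (_ : 2 * n%:R + n%:R * k = n%:R * (k + 2))//; ring.
Qed.

(** As N >= 2n, (1 - e)^(N - n) <= exp(-e N / 2), and e N = n exp(k/2) outgrows the entropy n(k +
    3). *)
Lemma counting_bound (n N : nat) (k : R) : (0 < n)%N ->
  N%:R = n%:R * expR k -> 16 <= k ->
  ('C(N + n, n) * 2 ^ n)%:R * (1 - expR (- (k / 2))) ^+ (N - n) <= expR (- n%:R).
Proof.
move=> n0 NE k16; have k0 : 0 <= k by lra.
have nR : 0 < n%:R :> R by rewrite ltr0n.
have nN : 2 * n%:R <= N%:R :> R.
  rewrite NE mulrC ler_pM2l//; apply: le_trans (expR_ge1Dx _); lra.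
have nleN : (n <= N)%N by rewrite -(ler_nat R); lra.
set e := expR (- (k / 2)).
have e0 : 0 < e by exact: expR_gt0.
have e1 : e <= 1 by rewrite -[leRHS](@expR0 R) ler_expR; lra.
have eN : e * N%:R = n%:R * expR (k / 2).
  by rewrite NE mulrCA -expRD; congr (_ * expR _); field.
have h1 : (1 - e) ^+ (N - n) <= expR (- (n%:R * (expR (k / 2) / 2))).
  apply: (@le_trans _ _ (expR (- e) ^+ (N - n))).
    by rewrite lerXn2r ?nnegrE ?expR_ge0 ?expR_ge1Dx// subr_ge0.
  rewrite -expRM_natr ler_expR natrB// mulNr lerN2 mulrA -eN.
  have : e * (2 * n%:R) <= e * N%:R by rewrite ler_pM2l.
  by rewrite mulrBr; lra.
have h2 : (2 ^ n)%:R <= expR n%:R :> R.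
  rewrite -[X in expR X]mulr1 expRM_natl natrX lerXn2r ?nnegrE ?expR_ge0//.
  by apply: le_trans (expR_ge1Dx _); lra.
rewrite natrM; apply: (@le_trans _ _ (expR (n%:R * (k + 2)) * expR n%:R *
    expR (- (n%:R * (expR (k / 2) / 2))))).
  rewrite ler_pM ?mulr_ge0 ?exprn_ge0 ?subr_ge0// ler_pM//.
  exact: binomial_le_exp.
rewrite -!expRD ler_expR.
have := ler_wpM2l (ltW nR) (half_exp_ge k16).
by rewrite !mulrDr; lra.
Qed.

End counting.

(** * Norm balls and measurability of the inclusion *)

Section ell_balls.
Context {R : realType}.

Lemma linf_ballP n (x : 'cV[R]_n) : ell_ball +oo n x -> forall i, `|x i 0| <= 1.
Proof. by move=> x1 i; apply: le_trans x1; exact: le_bigmax. Qed.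

Lemma l2_dilateP n (t : R) (x : 'cV[R]_n) :
  dilate t (ell_ball 2%:E n) x -> \sum_i x i 0 ^+ 2 <= t ^+ 2.
Proof.
move=> [y /= y1 <-].
rewrite (eq_bigr (fun i => t ^+ 2 * y i 0 ^+ 2)) => [|i _]; last first.
  by rewrite mxE exprMn.
rewrite -mulr_sumr ler_piMr ?sqr_ge0//; move: y1; rewrite /ell_ball /=.
rewrite (eq_bigr (fun i => y i 0 ^+ 2)) => [|i _]; last first.
  by rewrite powR_mulrn// real_normK ?num_real.
rewrite powR12_sqrt ?sumr_ge0// => [|i _]; last exact: sqr_ge0.
by rewrite -[X in _ <= X -> _]sqrtr1 ler_sqrt ?ltr01.
Qed.

Lemma l1_ballE N (q : 'cV[R]_N) : ell_ball 1%:E N q <-> \sum_i `|q i 0| <= 1.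
Proof.
rewrite /ell_ball /= invr1 powRr1; last by apply: sumr_ge0 => i _; exact: powR_ge0.
by under eq_bigr => i _ do rewrite powRr1//.
Qed.

(* Testing against countably many directions is what makes the event of the
   theorem measurable. *)
Lemma rational_polar N n (A : 'M[R]_(N, n)) (x : 'cV[R]_n) : (0 < N)%N ->
  (forall y : 'cV[rat]_n,
    (x^T *m map_mx ratr y) 0 0 <= \big[Num.max/0]_i `|(A *m map_mx ratr y) i 0|) ->
  [set A^T *m q | q in ell_ball 1%:E N] x.
Proof.
move=> N0 xA; case: (l1_ball_image_separation A x^T) => [[q q1 qA]|[y Ay]].
  exists q^T; last by rewrite -trmx_mul qA trmxK.
  by apply/l1_ballE; under eq_bigr => i _ do rewrite mxE.
exfalso; pose i1 : 'I_N := Ordinal N0.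
have xy0 : 0 < (x^T *m y) 0 0 by exact: le_lt_trans (Ay i1).
(* A quarter of the separation gap. [C] exceeds the l1-norms of x and of every row, so a rational
   point within h/C of y moves each pairing by at most h; both sides together lose at most 2h of the
   gap 4h. *)
pose h := ((x^T *m y) 0 0 - \big[Num.max/0]_i `|(A *m y) i 0|) / 4.
have h0 : 0 < h.
  by rewrite divr_gt0// subr_gt0 bigmax_lt// => i _; exact: Ay.
pose C := 1 + (\sum_j `|x j 0| + \sum_i \sum_j `|A i j|).
have C0 : 0 < C by rewrite ltr_wpDr// addr_ge0 ?sumr_ge0// => i _; exact: sumr_ge0.
have approx j : exists r : rat, `|ratr r - y j 0| < h / C.
  have : y j 0 < y j 0 + h / C by rewrite ltrDl divr_gt0.
  move/rat_in_itvoo => [r]; rewrite in_itv/= => /andP[r1 r2]; exists r.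
  by rewrite ger0_norm ?subr_ge0 ?ltW// ltrBlDl.
have [r ry] := choice approx.
have close m (B : 'M[R]_(m, n)) i : \sum_j `|B i j| <= C ->
    `|(B *m map_mx ratr (\col_j r j)) i 0 - (B *m y) i 0| <= h.
  move=> BC; rewrite !mxE -sumrB (le_trans (ler_norm_sum _ _ _))//.
  apply: (@le_trans _ _ (\sum_j `|B i j| * (h / C))).
    apply: ler_sum => j _; rewrite !mxE -mulrBr normrM ler_wpM2l//.
    exact/ltW/ry.
  rewrite -mulr_suml mulrCA; apply: ler_piMr; first exact: ltW.
  by rewrite ler_pdivrMr// mul1r.
have := xA (\col_j r j); apply/negP; rewrite -ltNge.
have xr : (x^T *m y) 0 0 - h <= (x^T *m map_mx ratr (\col_j r j)) 0 0.
  have := close _ x^T 0; rewrite ler_norml => /(_ _)/andP[|+ _]; last by lra.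
  rewrite (eq_bigr (fun j => `|x j 0|)) => [|j _]; last by rewrite mxE.
  rewrite /C; have : 0 <= \sum_i \sum_j `|A i j|.
    by apply: sumr_ge0 => i _; exact: sumr_ge0.
  by lra.
have max0 : 0 <= \big[Num.max/0]_i `|(A *m y) i 0| by exact: bigmax_ge_id.
apply: lt_le_trans xr; apply: bigmax_lt => [|i _]; first by rewrite /h; lra.
have := close _ A i; rewrite ler_norml => /(_ _)/andP[|lo hi].
  rewrite /C (bigD1 i)//=.
  have : 0 <= \sum_j `|x j 0| by exact: sumr_ge0.
  have : 0 <= \sum_(k | k != i) \sum_j `|A k j|.
    by apply: sumr_ge0 => k _; exact: sumr_ge0.
  by lra.
have : `|(A *m y) i 0| <= \big[Num.max/0]_i `|(A *m y) i 0|.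
  exact: (le_bigmax _ (fun i => `|(A *m y) i 0|)).
rewrite ler_norml => /andP[lo' hi'].
by rewrite ltr_norml; apply/andP; split; move: h0 xy0; rewrite /h in lo hi *; lra.
Qed.

Lemma polar_le N n (A : 'M[R]_(N, n)) (q : 'cV[R]_N) (y : 'cV[R]_n) :
  ell_ball 1%:E N q ->
  ((A^T *m q)^T *m y) 0 0 <= \big[Num.max/0]_i `|(A *m y) i 0|.
Proof.
move/l1_ballE => q1; set M := \big[_/_]_i _.
have M0 : 0 <= M by exact: bigmax_ge_id.
rewrite trmx_mul trmxK -mulmxA mxE.
apply: (@le_trans _ _ (\sum_i `|q i 0| * M)).
  apply: ler_sum => i _; rewrite mxE (le_trans (ler_norm _))// normrM.
  by rewrite ler_wpM2l//; exact: (le_bigmax _ (fun i => `|(A *m y) i 0|)).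
by rewrite -mulr_suml ler_piMl.
Qed.

(** Each rational direction asks a measurable function to lie in an upward-closed set of reals,
    which is an interval whatever Z is; [unpickle] enumerates the directions. *)
Lemma measurable_inclusion {d : measure_display} {T : measurableType d}
    (P : probability T R) N n (xi : 'I_N -> 'I_n -> {RV P >-> R})
    (Z : set 'cV[R]_n) : (0 < N)%N ->
  measurable [set w |
    Z `<=` [set (random_matrix xi w)^T *m x | x in ell_ball 1%:E N]].
Proof.
move=> N0; set E := [set w | _].
pose c (y : 'cV[rat]_n) w :=
  \big[Num.max/0]_i `|(random_matrix xi w *m map_mx ratr y) i 0|.
pose Ey y := c y @^-1` [set r | forall z, Z z -> (z^T *m map_mx ratr y) 0 0 <= r].
have mEy y : measurable (Ey y).
  have mc : measurable_fun setT (c y).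
    rewrite /c; elim: (index_enum _) => [|i s IH].
      by under eq_fun do rewrite big_nil; exact: measurable_cst.
    under eq_fun do rewrite big_cons; apply: measurable_maxr => //.
    apply: (@measurableT_comp _ _ _ T R R Num.norm setT
      (fun w => (random_matrix xi w *m map_mx ratr y) i 0)) => //.
    under eq_fun do rewrite mxE; apply: measurable_sum => j.
    by under eq_fun do rewrite mxE; apply: measurable_funM.
  rewrite -[Ey y]setTI; apply: mc => //; apply: is_interval_measurable.
  move=> r1 r2 h1 _ r3 /andP[r13 _] z Zz; apply: le_trans r13; exact: h1.
have -> : E = \bigcap_k (if unpickle k is Some y then Ey y else setT).
  apply/seteqP; split=> [w Ew k _|w Ew z Zz].
    case: unpickle => // y z Zz; have [q q1 <-] := Ew z Zz.
    exact: polar_le.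
  apply: rational_polar => // y.
  by have := Ew (pickle y) I; rewrite pickleK => /(_ z Zz).
by apply: bigcapT_measurable => k; case: unpickle.
Qed.

End ell_balls.

(** * Measurability in Cramer's rule *)

Section measurable_cramer.
Context {d : measure_display} {T : measurableType d} {R : realType}.

Lemma measurable_det m (M : T -> 'M[R]_m) :
  (forall i j, measurable_fun setT (fun w => M w i j)) ->
  measurable_fun setT (fun w => \det (M w)).
Proof.
move=> mM; apply: measurable_sum => p; apply: measurable_funM.
  exact: measurable_cst.
by apply: measurable_prod => i _; exact: mM.
Qed.

Lemma measurable_adj m (M : T -> 'M[R]_m) i j :
  (forall i j, measurable_fun setT (fun w => M w i j)) ->
  measurable_fun setT (fun w => (\adj (M w)) i j).
Proof.
move=> mM; under eq_fun do rewrite mxE; apply: measurable_funM.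
  exact: measurable_cst.
apply: measurable_det => k l; under eq_fun do rewrite !mxE; exact: mM.
Qed.

End measurable_cramer.

(** * The random polytope and its bad vertices *)

Section random_polytope.
Context {d : measure_display} {T : measurableType d} {R : realType}.
Variables (P : probability T R) (N n : nat).
Variable xi : 'I_N -> 'I_n -> {RV P >-> R}.
Variables (u v k : R).
Hypothesis (u0 : 0 < u) (v01 : 0 < v < 1).
Hypothesis ind_xi : mutually_independent (fun ij : 'I_N * 'I_n => xi ij.1 ij.2).
Hypothesis sym_xi : forall i j, symmetric_rv P (xi i j).
Hypothesis var_xi : forall i j, 'V_P[xi i j] = 1%E.
Hypothesis levy_xi : forall i j, (levy_concentration P (xi i j) u <= v%:E)%E.

Let beta := u * (1 - v) / 2.
Let kappa := 1 + (beta ^+ 2)^-1.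
Hypothesis k_large : 16 + 64 * kappa ^+ 2 <= k.

(** Half of the tilted mean [beta * H] at H = 1; since H >= 1 in the application, the threshold of
    [small_ball_lower_bound] is at least [s]. *)
Let s := beta / 2.
Let e := expR (- (k / 2)).

Let beta0 : 0 < beta.
Proof. by case/andP: v01 => _ v1; rewrite /beta divr_gt0// mulr_gt0// subr_gt0. Qed.

Let s0 : 0 < s. Proof. exact: divr_gt0. Qed.

Let k16 : 16 <= k.
Proof. by apply: le_trans k_large; rewrite lerDl mulr_ge0// sqr_ge0. Qed.

Let e1 : 0 <= 1 - e.
Proof.
rewrite subr_ge0 -[leRHS](@expR0 R) ler_expR; have := k16; lra.
Qed.

Let concentrated i j : (P [set w | (`|xi i j w| <= u)%R] <= v%:E)%E.
Proof.
apply: le_trans (levy_xi i j); apply: ereal_sup_ubound; exists 0 => //.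
by congr (P _); apply/seteqP; split => w /=; rewrite subr0.
Qed.

Let independent_row i : mutually_independent (xi i).
Proof.
move=> J A mA.
have inj : injective (fun j : 'I_n => (i, j)) by move=> j1 j2 [].
have := @ind_xi ((fun j => (i, j)) @: J)%SET (fun ij => A ij.2) (fun _ => mA _).
rewrite big_imset /=; last by move=> j1 j2 _ _; exact: inj.
move=> <-; congr (P _); apply/seteqP; split=> [w Aw _ /= /imsetP[j jJ ->]|w Aw j jJ].
  exact: Aw.
by apply: (Aw (i, j)); rewrite /= imset_f.
Qed.

Let admissible (x : 'cV[R]_n) := (forall j, `|x j 0| <= 1) /\ \sum_j x j 0 ^+ 2 <= k.

Let row_sum i (y : 'cV[R]_n) w := \sum_j xi i j w * y j 0.

Let measurable_row_sum i y : measurable_fun setT (row_sum i y).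
Proof. by apply: measurable_sum => j; apply: measurable_funM. Qed.

Let row_small_ball i (x y : 'cV[R]_n) : admissible x -> 1 <= (x^T *m y) 0 0 ->
  (P [set w | (`|row_sum i y w| <= s)%R] <= (1 - e)%:E)%E.
Proof.
move=> adm_x xy1.
(* Replace x by y / |y| when |y| exceeds x.y, so that |y| <= x.y. *)
have [z [adm_z zy1 yz]] : exists z : 'cV[R]_n,
    [/\ admissible z, 1 <= (z^T *m y) 0 0 &
        \sum_j y j 0 ^+ 2 <= (z^T *m y) 0 0 ^+ 2].
  set r := Num.sqrt (\sum_j y j 0 ^+ 2).
  have y2 : 0 <= \sum_j y j 0 ^+ 2 by apply: sumr_ge0 => j _; exact: sqr_ge0.
  have rr : \sum_j y j 0 ^+ 2 = r ^+ 2 by rewrite sqr_sqrtr.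
  have [ry|yr] := leP r ((x^T *m y) 0 0).
    by exists x; split => //; rewrite rr lerXn2r ?nnegrE ?sqrtr_ge0// (le_trans _ xy1).
  have r1 : 1 < r by exact: le_lt_trans yr.
  have r0 : 0 < r by lra.
  have zyr : ((r^-1 *: y)^T *m y) 0 0 = r.
    rewrite mxE (eq_bigr (fun j => r^-1 * y j 0 ^+ 2)) => [|j _]; last first.
      by rewrite !mxE -mulrA expr2.
    by rewrite -mulr_sumr rr expr2 mulKf// gt_eqF.
  exists (r^-1 *: y); rewrite zyr -rr; split => //; last exact: ltW.
  split=> [j|].
    rewrite mxE normrM normfV (gtr0_norm r0) mulrC ler_pdivrMr// mul1r.
    rewrite -[leLHS]sqrtr_sqr ler_wsqrtr// (bigD1 j)//= lerDl sumr_ge0// => l _.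
    exact: sqr_ge0.
  rewrite (eq_bigr (fun j => r ^- 2 * y j 0 ^+ 2)) => [|j _]; last first.
    by rewrite mxE exprMn exprVn.
  rewrite -mulr_sumr rr mulVf ?expf_neq0 ?gt_eqF//; have := k16; lra.
have zyE : \sum_j z j 0 * y j 0 = (z^T *m y) 0 0.
  by rewrite mxE; apply: eq_bigr => j _; rewrite mxE.
have := @small_ball_lower_bound _ _ _ P _ u v (xi i) u0 v01 (@independent_row i)
  (sym_xi i) (var_xi i) (concentrated i) (fun j => z j 0) (fun j => y j 0) k
  adm_z.1 adm_z.2.
rewrite zyE -/beta -/kappa => /(_ (lt_le_trans ltr01 zy1) yz) low.
set A := [set w | _]; have mA : measurable A.
  rewrite -[A]setTI; apply: (@measurable_fun_le _ T R setT
    (fun w => `|row_sum i y w|) (cst s)) => //.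
  exact: (@measurableT_comp _ _ _ T R R Num.norm setT (row_sum i y)).
have e_le : (e%:E <= P (~` A))%E.
  apply: (le_trans _ (le_trans low _)).
    rewrite lee_fin ler_pdivlMr; last first.
      by rewrite mulr_gt0// exprn_gt0// addr_gt0// invr_gt0 exprn_gt0.
    (* One factor exp(-k/4) is the cost of the tilt; the other absorbs 16 kappa^2, which is at most
       1 + k/4 by [k_large]. *)
    rewrite /e (_ : - (k / 2) = - (k / 4) + - (k / 4)); last by field.
    rewrite expRD -mulrA ler_piMr ?expR_ge0// mulrC expRN ler_pdivrMr ?expR_gt0//.
    by rewrite mul1r; apply: le_trans (expR_ge1Dx _); have := k_large; lra.
  apply: le_measure; rewrite ?inE//.
  - rewrite (_ : mkset _ = ~` [set w | row_sum i y w <= beta * (z^T *m y) 0 0 / 2]).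
      apply: measurableC; rewrite -[X in measurable X]setTI.
      exact: measurable_fun_le.
    apply/seteqP; split=> w /=; rewrite /row_sum.
      by under eq_bigr do rewrite mulrC; rewrite ltNge => /negP.
    by under [X in _ -> _ < X]eq_bigr do rewrite mulrC; rewrite ltNge => /negP.
  - exact: measurableC.
  - move=> w /= low_w; apply/negP; rewrite -ltNge; apply: lt_le_trans (ler_norm _).
    rewrite /row_sum; under eq_bigr do rewrite mulrC.
    apply: le_lt_trans low_w; rewrite /s ler_pM2r ?invr_gt0//.
    by rewrite ler_peMr// ltW.
have PA : P A \is a fin_num by exact: fin_num_measure.
move: e_le; rewrite probability_setC// -(fineK PA) -EFinB !lee_fin; lra.
Qed.

Let row_entries i : {set 'I_N * 'I_n} := [set ij | ij.1 == i].

Let rows_small_ball (I : {set 'I_N}) (x y : 'cV[R]_n) :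
  admissible x -> 1 <= (x^T *m y) 0 0 ->
  (P (\big[setI/setT]_(i <- enum I) [set w | (`|row_sum i y w| <= s)%R]) <=
   ((1 - e) ^+ #|I|)%:E)%E.
Proof.
move=> adm_x xy1.
rewrite (@independent_bigcap _ _ _ P _ _ ind_xi _ row_entries)//.
- have -> : #|I| = size (enum I) by rewrite cardE.
  elim: (enum I) => [|i l IH]; first by rewrite big_nil.
  rewrite big_cons /= exprS EFinM; apply: lee_pmul => //.
    by apply: prode_ge0 => j _; exact: measure_ge0.
  exact: row_small_ball adm_x xy1.
- exact: enum_uniq.
- move=> i l il; rewrite -setI_eq0; apply/eqP/setP => -[a b]; rewrite !inE /=.
  by apply/negP => /andP[/eqP -> /eqP ]; exact/eqP.
- move=> i.
  pose T1 := g_sigma_algebraType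
    (cylinders (fun ij : 'I_N * 'I_n => xi ij.1 ij.2) (row_entries i)).
  have m1 : measurable_fun [set: T1] (row_sum i y : T1 -> R).
    apply: measurable_sum => j; apply: measurable_funM => //.
    apply: (@measurable_cylinders _ _ _ P _
      (fun ij : 'I_N * 'I_n => xi ij.1 ij.2) (row_entries i) (i, j)).
    by rewrite inE.
  have : measurable (setT `&` [set w : T1 | `|row_sum i y w| <= s]).
    apply: (@measurable_fun_le _ T1 R setT
      (fun w => `|row_sum i y w|) (cst s)) => //.
    exact: (@measurableT_comp _ _ _ T1 R R Num.norm setT (row_sum i y)).
  by rewrite setTI.
Qed.

Hypothesis (n0 : (0 < n)%N) (N0 : (0 < N)%N).

(** The identity block encodes the box |y_j| <= 1 and gives the system full column rank for every w,
    so vertices always exist. *)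
Let matB w : 'M[R]_(N + n, n) := col_mx (random_matrix xi w) 1%:M.
Let bound (i : 'I_(N + n)) : R := if fintype.split i is inl _ then s else 1.
(** The default value is never reached when #|K| = n. *)
Let idx (K : {set 'I_(N + n)}) (k : 'I_n) := nth (rshift N (Ordinal n0)) (enum K) k.
Let rhs K (sg : {ffun 'I_n -> bool}) : 'cV[R]_n :=
  \col_k ((-1) ^+ sg k * bound (idx K k)).
Let matK K w : 'M[R]_n := rowsub (idx K) (matB w).
(** Cramer's numerator: the vertex multiplied by the determinant. It is polynomial in the used
    entries and makes sense for a singular system too. *)
Let numer K sg w : 'cV[R]_n := \adj (matK K w) *m rhs K sg.
Let outside (K : {set 'I_(N + n)}) : {set 'I_N} := [set i | lshift n i \notin K].
Let used (K : {set 'I_(N + n)}) : {set 'I_N * 'I_n} :=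
  [set ij | lshift n ij.1 \in K].

Let card_outside (K : {set 'I_(N + n)}) : #|K| = n -> (N - n <= #|outside K|)%N.
Proof.
move=> cardK; have := cardsC (outside K); rewrite card_ord => NE.
rewrite leq_subLR -[X in (X <= _)%N]NE addnC leq_add2r -cardK.
rewrite -(card_imset _ (@lshift_inj N n)); apply: subset_leq_card.
by apply/fintype.subsetP => _ /imsetP[i + ->]; rewrite !inE negbK.
Qed.

Let entries (ij : 'I_N * 'I_n) := xi ij.1 ij.2.

(** The first component supplies the vertex and the second the rows tested against it; the
    inequality is |X_i.y| <= s multiplied by |det|. *)
Let bad_pair K sg (z : T * T) := forall i, i \in outside K ->
  `|row_sum i (numer K sg z.1) z.2| <= s * `|\det (matK K z.1)|.

(** The first clause alone need not be rare: the system may be singular, or the vertex too short for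
    the small ball bound. The second keeps only those w for which independently redrawn outside rows
    are rarely bad, a measurable condition mentioning no x. *)
Let bad K sg : set T := [set w | bad_pair K sg (w, w) /\
  (P [set w' | bad_pair K sg (w, w')] <= ((1 - e) ^+ (N - n))%:E)%E].

(** The system involves only the entries in [used K] and the tested rows only the others, so
    [diagonal_section_bound] applies to these two independent sigma-algebras. *)
Let badP (K : {set 'I_(N + n)}) sg : #|K| = n ->
  measurable (bad K sg) /\ (P (bad K sg) <= ((1 - e) ^+ (N - n))%:E)%E.
Proof.
move=> cardK.
set G1 := cylinders entries (used K); set G2 := cylinders entries (~: used K).
have disj : [disjoint used K & ~: used K]%B by rewrite -setI_eq0 finset.setICr.
apply: (@diagonal_section_bound _ _ _ P G1 G2 (@cylinders_measurable _ _ _ _ _ _ _)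
  (@cylinders_measurable _ _ _ _ _ _ _)
  (independent_cylinders ind_xi disj) (bad_pair K sg)).
  exact: exprn_ge0.
set T1 := g_sigma_algebraType G1; set T2 := g_sigma_algebraType G2.
have mM a b : measurable_fun [set: T1] (fun w : T1 => matK K w a b).
  have : idx K a \in K by rewrite -mem_enum mem_nth// -cardE cardK.
  under eq_fun do rewrite mxE.
  case: (split_ordP (idx K a)) => i ->.
    move=> iK; under eq_fun do rewrite col_mxEu mxE.
    by apply: (@measurable_cylinders _ _ _ P _ entries (used K) (i, b)); rewrite inE.
  by move=> _; under eq_fun do rewrite col_mxEd; exact: measurable_cst.
have mnum j : measurable_fun [set: T1] (fun w : T1 => numer K sg w j 0).
  under eq_fun do rewrite mxE; apply: measurable_sum => l.
  by apply: measurable_funM => //; exact: (measurable_adj _ _ mM).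
have mdet : measurable_fun [set: T1] (fun w : T1 => \det (matK K w)).
  exact: measurable_det.
have -> : bad_pair K sg = \bigcap_(i in [set` outside K])
    [set z : T1 * T2 | `|row_sum i (numer K sg z.1) z.2| <=
                       s * `|\det (matK K z.1)|].
  by apply/seteqP; split=> z zb i; exact: zb.
apply: fin_bigcap_measurable => // i iK.
rewrite -[X in measurable X]setTI; apply: measurable_fun_le => //.
  apply: (@measurableT_comp _ _ _ (T1 * T2)%type R R Num.norm setT
    (fun z => row_sum i (numer K sg z.1) z.2)) => //.
  apply: measurable_sum => j; apply: measurable_funM.
    apply: (@measurableT_comp _ _ _ (T1 * T2)%type T2 R (xi i j) setT snd) => //.
    by apply: (@measurable_cylinders _ _ _ P _ entries (~: used K) (i, j));
      rewrite !inE; move: iK; rewrite /= inE.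
  exact: (@measurableT_comp _ _ _ (T1 * T2)%type T1 R
    (fun w => numer K sg w j 0) setT fst).
apply: measurable_funM => //.
apply: (@measurableT_comp _ _ _ (T1 * T2)%type R R Num.norm setT
    (fun z => \det (matK K z.1))) => //.
exact: (@measurableT_comp _ _ _ (T1 * T2)%type T1 R
    (fun w => \det (matK K w)) setT fst).
Qed.

Let numer_vertex K sg w (y : 'cV[R]_n) : matK K w *m y = rhs K sg ->
  numer K sg w = \det (matK K w) *: y.
Proof. by move=> My; rewrite /numer -My mulmxA mul_adj_mx mul_scalar_mx. Qed.

Let row_sumZ i (a : R) (y : 'cV[R]_n) w :
  row_sum i (a *: y) w = a * row_sum i y w.
Proof. by rewrite /row_sum mulr_sumr; apply: eq_bigr => j _; rewrite mxE mulrCA. Qed.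

(** With w fixed the vertex y is deterministic; dividing by |det| > 0 leaves the small ball event
    for the rows outside K, at least N - n in number. *)
Let section_bound (K : {set 'I_(N + n)}) sg w (x y : 'cV[R]_n) : #|K| = n ->
  matK K w \in unitmx -> matK K w *m y = rhs K sg ->
  admissible x -> 1 <= (x^T *m y) 0 0 ->
  (P [set w' | bad_pair K sg (w, w')] <= ((1 - e) ^+ (N - n))%:E)%E.
Proof.
move=> cardK Munit My adm_x xy1.
have det0 : 0 < `|\det (matK K w)|.
  by rewrite normr_gt0 -unitfE -unitmxE.
rewrite [X in P X](_ : _ = \big[setI/setT]_(i <- enum (outside K))
    [set w' | `|row_sum i y w'| <= s]).
  apply: le_trans (rows_small_ball _ adm_x xy1) _; rewrite lee_fin.
  apply: ler_wiXn2l (card_outside cardK) => //.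
  by rewrite gerBl expR_ge0.
have E i w' : (`|row_sum i (numer K sg w) w'| <= s * `|\det (matK K w)|) =
    (`|row_sum i y w'| <= s).
  by rewrite (numer_vertex My) row_sumZ normrM mulrC ler_pM2r.
rewrite -bigcap_seq; apply/seteqP; split=> [w' bw i /=|w' bw i iK].
  by rewrite mem_enum => iK; rewrite -E; exact: bw.
by rewrite E; apply: bw; rewrite /= mem_enum.
Qed.

Let body := ell_ball +oo n `&` dilate (Num.sqrt k) (ell_ball 2%:E n).

Let body_admissible x : body x -> admissible x.
Proof.
move=> [/linf_ballP x1 /l2_dilateP]; rewrite sqr_sqrtr => [xk|]; first by split.
by have := k16; lra.
Qed.

Let unit_admissible (a : R) j : `|a| <= 1 -> admissible (a *: delta_mx j 0).
Proof.
move=> a1; split=> [l|].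
  rewrite !mxE eqxx andbT; case: eqP => _; rewrite ?mulr1// mulr0 normr0//.
rewrite (bigD1 j)//= big1 => [|l /negPf lj]; last first.
  by rewrite !mxE lj mulr0 expr0n.
rewrite !mxE !eqxx mulr1 addr0 -real_normK ?num_real//.
apply: (@le_trans _ _ 1); first by rewrite -[leRHS](expr1n _ 2) lerXn2r ?nnegrE.
by have := k16; lra.
Qed.

Let good := [set w | dilate s body `<=`
  [set (random_matrix xi w)^T *m x | x in ell_ball 1%:E N]].

(** The separating y is divided by the larger of h = x0.y and |y|_oo. In the first case x0 is the
    witness; in the second it is the signed unit vector of the largest coordinate, itself
    admissible. *)
Let normalized_separation w : ~ good w -> exists x y : 'cV[R]_n,
  [/\ admissible x, 1 <= (x^T *m y) 0 0, forall i, `|row_sum i y w| <= s &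
      forall j, `|y j 0| <= 1].
Proof.
move=> bad_w; have [x0 [x0L x0N]] : exists x0, body x0 /\
    ~ [set (random_matrix xi w)^T *m x | x in ell_ball 1%:E N] (s *: x0).
  apply: contrapT => h; apply: bad_w => _ [x0 x0L <-]; apply: contrapT => x0N.
  by apply: h; exists x0.
have [[q q1 qx]|[y Hy]] :=
    l1_ball_image_separation (random_matrix xi w) (s *: x0)^T.
  exfalso; apply: x0N; exists q^T; last by rewrite -trmx_mul qx trmxK.
  by apply/l1_ballE; under eq_bigr => i _ do rewrite mxE.
set h := (x0^T *m y) 0 0.
have rowE i : ((random_matrix xi w) *m y) i 0 = row_sum i y w.
  by rewrite mxE; apply: eq_bigr => j _; rewrite mxE.
have row_lt i : `|row_sum i y w| < s * h.
  by rewrite -rowE (lt_le_trans (Hy i))// linearZ/= -scalemxAl [leLHS]mxE.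
have scaled c i : 0 < c -> h <= c -> `|row_sum i (c^-1 *: y) w| <= s.
  move=> c0 hc; rewrite row_sumZ normrM normfV (gtr0_norm c0) mulrC ler_pdivrMr//.
  by apply: le_trans (ltW (row_lt i)) _; rewrite ler_pM2l.
have [yh|] := pselect (forall j, `|y j 0| <= h).
  have [h0|h0] := ltP 0 h.
    exists x0, (h^-1 *: y); split => [|||j]; first exact: body_admissible.
    - by rewrite -scalemxAr mxE mulVf// gt_eqF.
    - by move=> i; exact: scaled.
    - by rewrite mxE normrM normfV (gtr0_norm h0) mulrC ler_pdivrMr// mul1r.
  (* With h <= 0 the bound |y_j| <= h forces y = 0, against the strict inequality for some row
     (there is one since N > 0). *)
  exfalso; have y0 : y = 0.
    apply/colP => j; rewrite [RHS]mxE; apply/eqP; rewrite -normr_le0.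
    exact: le_trans (yh j) h0.
  have := row_lt (Ordinal N0).
  by rewrite /h y0 mulmx0 mxE mulr0 normr_lt0.
move/existsNP => [j0 /negP]; rewrite -ltNge => hj0.
pose j := [arg max_(j > j0) `|y j 0|]%O.
have jmax l : `|y l 0| <= `|y j 0| by rewrite /j; case: arg_maxP => // a _; apply.
have hj : h <= `|y j 0| by apply: le_trans (ltW hj0) (jmax j0).
have yj0 : 0 < `|y j 0|.
  rewrite normr_gt0; apply/negP => /eqP yj; have := row_lt (Ordinal N0).
  apply/negP; rewrite -leNgt (le_trans _ (normr_ge0 _))// pmulr_rle0//.
  by rewrite (le_trans hj)// yj normr0.
exists (Num.sg (y j 0) *: delta_mx j 0), (`|y j 0|^-1 *: y); split => [|||l].
- by apply: unit_admissible; rewrite normr_sg; case: eqP.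
- rewrite mxE (bigD1 j)//= big1 => [|l /negPf lj]; last first.
    by rewrite !mxE lj mulr0 mul0r.
  by rewrite !mxE !eqxx mulr1 addr0 mulrCA -normrEsg mulVf// gt_eqF.
- by move=> i; exact: scaled.
- by rewrite mxE normrM normfV normr_id mulrC ler_pdivrMr// mul1r.
Qed.

Let boundE i : bound (lshift n i) = s.
Proof. by rewrite /bound -[lshift n i]/(unsplit (inl i)) unsplitK. Qed.

Let choices : {set {set 'I_(N + n)} * {ffun 'I_n -> bool}} :=
  finset.setX [set K : {set 'I_(N + n)} | #|K| == n]%SET finset.setT.

Let card_choices : #|choices| = ('C(N + n, n) * 2 ^ n)%N.
Proof. by rewrite cardsX card_draws cardsT card_ffun card_bool !card_ord. Qed.

(** The separating y is pushed to a vertex y' with x.y' >= 1; K is a basis of tight constraints and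
    [sg] their signs. Here x depends on w, harmlessly: it serves only to verify the second clause of
    [bad]. *)
Let bad_cover w : ~ good w -> exists q, q \in choices /\ bad q.1 q.2 w.
Proof.
case/normalized_separation => x [y [adm_x xy1 rowy y1]].
have fullB : row_full (matB w).
  apply/row_fullP; exists (row_mx 0 1%:M).
  by rewrite mul_row_col mul0mx add0r mulmx1.
have rowB i : ((random_matrix xi w) *m y) i 0 = row_sum i y w.
  by rewrite mxE; apply: eq_bigr => j _; rewrite mxE.
have feas i : `|(matB w *m y) i 0| <= bound i.
  rewrite mul_col_mx mul1mx /bound; case: split_ordP => a ->.
    by rewrite col_mxEu rowB.
  by rewrite col_mxEd.
have [J [y' [feas' act cy full]]] := polyhedron_vertex x^T fullB feas.
have [K [KJ cardK Kunit]] := vertex_basis full.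
pose sg : {ffun 'I_n -> bool} := [ffun l => (matB w *m y') (idx K l) 0 < 0].
have Munit : matK K w \in unitmx by exact: Kunit.
have My : matK K w *m y' = rhs K sg.
  apply/colP => l; rewrite [RHS]mxE /sg ffunE.
  have lK : idx K l \in J.
    by apply: (fintype.subsetP KJ); rewrite -mem_enum mem_nth// -cardE cardK.
  by rewrite -(act _ lK) /matK mul_rowsub_mx mxE [LHS]numEsign.
have xy'1 : 1 <= (x^T *m y') 0 0 by exact: le_trans cy.
exists (K, sg); split; first by rewrite !inE cardK eqxx.
split; last exact: section_bound cardK Munit My adm_x xy'1.
move=> i iK /=; rewrite (numer_vertex My) row_sumZ normrM mulrC ler_wpM2r//.
have := feas' (lshift n i); rewrite boundE mul_col_mx col_mxEu.
by rewrite mxE; under eq_bigr do rewrite mxE.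
Qed.

Lemma random_polytope_bound : N%:R = n%:R * expR k ->
  ((1 - expR (- n%:R))%:E <= P good)%E.
Proof.
move=> NE.
have mgood : measurable good by exact: measurable_inclusion.
have : (P (~` good) <= ((1 - e) ^+ (N - n) *+ #|[pred q | q \in choices]|)%:E)%E.
  apply: (union_bound (D := fun q => bad q.1 q.2)) => //.
  - exact: measurableC.
  - by move=> q; rewrite !inE andbT => /eqP; exact: badP.
rewrite probability_setC// (eq_card (B := mem choices)) ?card_choices// => h.
have PG : P good \is a fin_num by exact: fin_num_measure.
move: h; rewrite -(fineK PG) -EFinB !lee_fin -mulr_natl => h.
by have := counting_bound n0 NE k16; rewrite -/e; lra.
Qed.

End random_polytope.

Theorem theorem1p1 (R : realType) :
  exists2 c : R, 0 < c &
  forall u v : R, 0 < u < 1 -> 0 < v < 1 ->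
  exists b M : R, [/\ 0 < b, 0 < M &
  forall (n N : nat), (0 < n)%N -> (0 < N)%N -> M * n%:R <= N%:R ->
  forall (d : measure_display) (T : measurableType d) (P : probability T R)
    (xi : 'I_N -> 'I_n -> {RV P >-> R}),
    mutually_independent (fun ij : 'I_N * 'I_n => xi ij.1 ij.2) ->
    (forall i j, symmetric_rv P (xi i j)) ->
    (forall i j, 'V_P[xi i j] = 1%E) ->
    (forall i j k, identically_distributed P (xi i j) (xi i k)) ->
    (forall i j, (levy_concentration P (xi i j) u <= v%:E)%E) ->
    ((1 - expR (- (c * n%:R)))%:E <=
      P [set w |
        dilate b^-1
          (ell_ball +oo n `&`
           dilate (Num.sqrt (ln (N%:R / n%:R))) (ell_ball 2%:E n))
        `<=` [set (random_matrix xi w)^T *m x | x in ell_ball 1%:E N]])%E].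
Proof.
exists 1 => // u v /andP[u0 _] v01; have /andP[v0 v1] := v01.
pose beta := u * (1 - v) / 2; pose kappa := 1 + (beta ^+ 2)^-1.
have beta0 : 0 < beta by rewrite divr_gt0// mulr_gt0// subr_gt0.
(* b^-1 is the small ball threshold [s], and N >= M n says exactly that k = ln(N/n) satisfies
   [k_large]. *)
exists (beta / 2)^-1, (expR (16 + 64 * kappa ^+ 2)); split.
- by rewrite invr_gt0 divr_gt0.
- exact: expR_gt0.
move=> n N n0 N0 MN d T P xi ind_xi sym_xi var_xi _ levy_xi.
have nR : 0 < n%:R :> R by rewrite ltr0n.
have r0 : 0 < N%:R / n%:R :> R by rewrite divr_gt0 ?ltr0n.
rewrite invrK mul1r.
apply: random_polytope_bound => //.
- by rewrite -ler_expR lnK ?posrE// ler_pdivlMr.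
- by rewrite lnK ?posrE// mulrCA divff ?mulr1// gt_eqF.
Qed.
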